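(* The problem Time-respecting Arborescence Reconfiguration can be solved in polynomial time. That is, there is a polynomial-time algorithm which, given a finite digraph $D=(V,A)$ (possibly with multiple arcs), a function $\lambda\colon A\to\mathbb{R}_+$, and two time-respecting arborescences $T_1$ and $T_2$ in $D$ (whose roots may differ), decides whether there exists a reconfiguration sequence from $T_1$ to $T_2$ all of whose members are time-respecting arborescences in $D$.
   Context: $\mathbb{R}_+$ is the set of non-negative reals. For $r\in V$, an $r$-arborescence in $D$ is a spanning acyclic subgraph of $D$ in which there is exactly one directed path from $r$ to every vertex; an arborescence is an $r$-arborescence for some $r\in V$. A directed path traversing arcs $e_1,\dots,e_k$ in this order is time-respecting for $\lambda$ if $\lambda(e_i)\le\lambda(e_{i+1})$ for $1\le i<k$. An arborescence is time-respecting if every directed path in it is time-respecting. A reconfiguration sequence from $T_1$ to $T_2$ is a sequence $(T^0,\dots,T^\ell)$ of time-respecting arborescences in $D$ with $T^0=T_1$, $T^\ell=T_2$ and $|A(T^i)\setminus A(T^{i+1})|=|A(T^{i+1})\setminus A(T^i)|=1$ for $0\le i<\ell$, where $A(\cdot)$ denotes the arc set. The intermediate arborescences may have any roots. Labels are given in a standard finite encoding (e.g. as non-negative rationals). *)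

(* Defs.v *)
From mathcomp Require Import all_boot all_order all_algebra.

Set Implicit Arguments.
Unset Strict Implicit.
Unset Printing Implicit Defensive.

Import Order.TTheory GRing.Theory Num.Theory.

(* Parallel arcs are distinct elements of 'I_(na D) with equal ends; loops are
   not excluded. *)
Record digraph := Digraph {
  nv : nat;
  na : nat;
  arc_tail : 'I_na -> 'I_nv;
  arc_head : 'I_na -> 'I_nv
}.

(* A spanning subgraph of D is identified with its arc set, so walks, paths and
   cycles are sequences of arcs. *)
Fixpoint diwalk (D : digraph) (T : {set 'I_(na D)}) (u : 'I_(nv D))
    (p : seq 'I_(na D)) (v : 'I_(nv D)) : bool :=
  if p is e :: p' then [&& e \in T, arc_tail e == u & diwalk T (arc_head e) p' v]
  else u == v.

Definition dipath (D : digraph) (T : {set 'I_(na D)}) (u : 'I_(nv D))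
    (p : seq 'I_(na D)) (v : 'I_(nv D)) : bool :=
  diwalk T u p v && uniq (u :: [seq arc_head e | e <- p]).

Definition dicycle (D : digraph) (T : {set 'I_(na D)}) (u : 'I_(nv D))
    (p : seq 'I_(na D)) : bool :=
  [&& p != [::], diwalk T u p u & uniq [seq arc_head e | e <- p]].

Definition acyclic (D : digraph) (T : {set 'I_(na D)}) : Prop :=
  forall (u : 'I_(nv D)) (p : seq 'I_(na D)), ~~ dicycle T u p.

Definition rooted_arborescence (D : digraph) (r : 'I_(nv D))
    (T : {set 'I_(na D)}) : Prop :=
  acyclic T /\
  forall v : 'I_(nv D), exists! p : seq 'I_(na D), dipath T r p v.

Definition arborescence (D : digraph) (T : {set 'I_(na D)}) : Prop :=
  exists r : 'I_(nv D), rooted_arborescence r T.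

Definition time_respecting_path (D : digraph) (lam : 'I_(na D) -> rat)
    (p : seq 'I_(na D)) : bool :=
  sorted (fun e f => (lam e <= lam f)%R) p.

Definition time_respecting_arborescence (D : digraph)
    (lam : 'I_(na D) -> rat) (T : {set 'I_(na D)}) : Prop :=
  arborescence T /\
  forall (u v : 'I_(nv D)) (p : seq 'I_(na D)),
    dipath T u p v -> time_respecting_path lam p.

(* Only Ts 0, ..., Ts l matter. *)
Definition reconfiguration_sequence (D : digraph) (lam : 'I_(na D) -> rat)
    (T1 T2 : {set 'I_(na D)}) (l : nat) (Ts : nat -> {set 'I_(na D)}) : Prop :=
  [/\ Ts 0 = T1, Ts l = T2,
      forall i, i <= l -> time_respecting_arborescence lam (Ts i) &
      forall i, i < l ->
        #|Ts i :\: Ts i.+1| = 1 /\ #|Ts i.+1 :\: Ts i| = 1].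

Record tar_instance := TarInstance {
  graph : digraph;
  label : 'I_(na graph) -> rat;
  source : {set 'I_(na graph)};
  target : {set 'I_(na graph)}
}.

Definition valid_instance (I : tar_instance) : Prop :=
  [/\ forall e, (0 <= @label I e)%R,
      time_respecting_arborescence (@label I) (source I) &
      time_respecting_arborescence (@label I) (target I)].

Definition reconfigurable (I : tar_instance) : Prop :=
  exists (l : nat) (Ts : nat -> {set 'I_(na (graph I))}),
    reconfiguration_sequence (@label I) (source I) (target I) l Ts.

(* The model of computation is first-order Lisp: call-by-value, mutually
   recursive first-order functions on binary trees, where every evaluation step
   has unit cost.  There is no equality test or arithmetic on whole trees: the
   only operations are cons, hd, tl and the test for nil (Leaf), each of which takes
   constant time on a heap of shared cons cells.  Polynomial time in this model
   therefore coincides with polynomial time on Turing machines (N. D. Jones,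
   Computability and Complexity from a Programming Perspective, 1997). *)
Inductive tree : Type :=
| Leaf
| Node of tree & tree.

Fixpoint tree_size (x : tree) : nat :=
  if x is Node y z then (tree_size y + tree_size z).+1 else 1.

Definition tree_hd (x : tree) : tree := if x is Node y _ then y else Leaf.
Definition tree_tl (x : tree) : tree := if x is Node _ z then z else Leaf.

(* Variables are de Bruijn indices.  A function has one parameter, which is the
   only variable free in its body; several arguments are passed as a tree. *)
Inductive expr : Type :=
| EVar of nat
| ENil
| ECons of expr & expr
| EHd of expr
| ETl of expr
| EIf of expr & expr & expr
| ELet of expr & expr
| ECall of nat & expr.

(* eval F env e v t: with function bodies F, the expression e evaluates to v in
   exactly t steps. *)
Inductive eval (F : seq expr) : seq tree -> expr -> tree -> nat -> Prop :=
| EvalVar env i : eval F env (EVar i) (nth Leaf env i) 1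
| EvalNil env : eval F env ENil Leaf 1
| EvalCons env e1 e2 v1 v2 t1 t2 :
    eval F env e1 v1 t1 -> eval F env e2 v2 t2 ->
    eval F env (ECons e1 e2) (Node v1 v2) (t1 + t2).+1
| EvalHd env e v t : eval F env e v t -> eval F env (EHd e) (tree_hd v) t.+1
| EvalTl env e v t : eval F env e v t -> eval F env (ETl e) (tree_tl v) t.+1
| EvalIfCons env e e1 e2 x y v t t1 :
    eval F env e (Node x y) t -> eval F env e1 v t1 ->
    eval F env (EIf e e1 e2) v (t + t1).+1
| EvalIfNil env e e1 e2 v t t2 :
    eval F env e Leaf t -> eval F env e2 v t2 ->
    eval F env (EIf e e1 e2) v (t + t2).+1
| EvalLet env e1 e2 v1 v2 t1 t2 :
    eval F env e1 v1 t1 -> eval F (v1 :: env) e2 v2 t2 ->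
    eval F env (ELet e1 e2) v2 (t1 + t2).+1
| EvalCall env f e x v t1 t2 :
    eval F env e x t1 -> eval F [:: x] (nth ENil F f) v t2 ->
    eval F env (ECall f e) v (t1 + t2).+1.

Lemma eval_deterministic (F : seq expr) (env : seq tree) (e : expr)
    (v v' : tree) (t t' : nat) :
  eval F env e v t -> eval F env e v' t' -> v = v' /\ t = t'.
Proof.
move=> ev; elim: ev v' t' => {env e v t}; intros;
  match goal with ev : eval _ _ _ ?v' ?t' |- _ = ?v' /\ _ = ?t' =>
    inversion ev; clear ev; subst
  end;
  repeat match goal with
  | IH : forall v' t', eval _ _ ?e v' t' -> _, ev : eval _ _ ?e _ _ |- _ =>
      case: (IH _ _ ev) => ? ?; clear IH ev; subst; try discriminate
  end; by [].
Qed.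

Definition enc_bool (b : bool) : tree := if b then Node Leaf Leaf else Leaf.

(* Decides yes on the inputs satisfying valid; nothing is required of the
   behaviour on other inputs. *)
Definition poly_time_decidable (X : Type) (encode : X -> tree)
    (valid yes : X -> Prop) : Prop :=
  exists (F : seq expr) (main : expr) (q : {poly nat}),
    forall x : X, valid x ->
      exists (b : bool) (t : nat),
        [/\ eval F [:: encode x] main (enc_bool b) t,
            t <= q.[tree_size (encode x)]%R &
            b <-> yes x].

Fixpoint bits_of_pos (p : BinNums.positive) : seq bool :=
  match p with
  | BinNums.xH => [:: true]
  | BinNums.xO p' => false :: bits_of_pos p'
  | BinNums.xI p' => true :: bits_of_pos p'
  end.

Definition bits (n : nat) : seq bool :=
  if bin_of_nat n is BinNums.Npos p then bits_of_pos p else [::].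

Definition enc_seq (X : Type) (enc : X -> tree) (s : seq X) : tree :=
  foldr (fun x y => Node (enc x) y) Leaf s.

(* Binary, least significant bit first. *)
Definition enc_nat (n : nat) : tree := enc_seq enc_bool (bits n).

(* Numerator and denominator in lowest terms; the sign is dropped, as labels are
   non-negative. *)
Definition enc_label (x : rat) : tree :=
  Node (enc_nat `|numq x|%N) (enc_nat `|denq x|%N).

Definition enc_arc (I : tar_instance) (e : 'I_(na (graph I))) : tree :=
  Node (enc_nat (arc_tail e)) (Node (enc_nat (arc_head e)) (enc_label (label e))).

(* Arc sets are given by their characteristic vectors. *)
Definition enc_arcs (m : nat) (T : {set 'I_m}) : tree :=
  enc_seq (fun e => enc_bool (e \in T)) (enum 'I_m).

Definition enc_instance (I : tar_instance) : tree :=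
  Node (enc_nat (nv (graph I)))
    (Node (enc_seq (@enc_arc I) (enum 'I_(na (graph I))))
      (Node (enc_arcs (source I)) (enc_arcs (target I)))).

(* Main.v *)
Require Import Defs.
From mathcomp Require Import all_boot all_order all_algebra.
From mathcomp Require Import zify.

(* Let e precede f when f starts at the head of e and is not earlier, and call e
   full when the arcs that time-respecting walks starting with e can end in have
   all vertices as heads.

   A time-respecting r-arborescence can always be turned into the earliest-arrival
   r-arborescence T0: inserting an arc of T0 whose tail is already reached inside
   the common part keeps it time-respecting, because arcs of T0 are no later than
   their competitors.  Hence only roots matter.

   If e is full, the earliest-arrival arborescence of the walks that start with e
   is rooted at the head of e, and exchanging its arc into the tail of e for e
   moves the root there.  Conversely, let a swap with f leaving and e entering
   move the root from r to r'.  If e is not later than f, then e precedes the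
   arcs of the old arborescence at r, so e is full, and so are the arcs of the new
   one on its path from r' to r, since they lead to e; otherwise exchange the two
   arborescences.  Hence reachability is connectedness of the roots by full arcs.

   That criterion consists of two graph searches and comparisons of rationals.  The
   functions computable in polynomial time with polynomially bounded output
   contain the operations on trees and are closed under composition, pairing,
   branching and bounded iteration over lists, so the decision procedure can be
   written as a function on trees. *)

Set Implicit Arguments.
Unset Strict Implicit.
Unset Printing Implicit Defensive.

Import Order.TTheory GRing.Theory Num.Theory.

(** * Reachability of time-respecting arborescences *)

Section TimeRespectingArborescences.

Variables (D : digraph) (lam : 'I_(na D) -> rat).
Local Notation V := 'I_(nv D).
Local Notation A := 'I_(na D).
Local Notation tl := (@arc_tail D).
Local Notation hd := (@arc_head D).
Implicit Types (T : {set A}) (u v r : V) (e f g : A) (p q : seq A).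

(** * A local form of time-respecting arborescences *)

Definition arc_rel T : rel V := [rel u v | [exists e in T, (tl e == u) && (hd e == v)]].

(** Conditions on single arcs, pairs of arcs and reachability replace the quantification over paths,
    so that the result of exchanging one arc can be checked arc by arc. *)
Definition tra r T : bool :=
  [&& [forall e in T, hd e != r],
      [forall e in T, forall f in T, (hd e == hd f) ==> (e == f)],
      [forall v, connect (arc_rel T) r v] &
      [forall e in T, forall f in T, (hd e == tl f) ==> (lam e <= lam f)%R]].

Lemma traP r T : reflect
  [/\ forall e, e \in T -> hd e != r,
      forall e f, e \in T -> f \in T -> hd e = hd f -> e = f,
      forall v, connect (arc_rel T) r v &
      forall e f, e \in T -> f \in T -> hd e = tl f -> (lam e <= lam f)%R]
  (tra r T).
Proof.
apply: (iffP and4P) => [[h1 h2 h3 h4]|[h1 h2 h3 h4]]; split.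
- by move=> e eT; apply: (forall_inP h1).
- move=> e f eT fT /eqP ef; apply/eqP.
  exact: (implyP (forall_inP (forall_inP h2 _ eT) _ fT)).
- by move=> v; apply: (forallP h3).
- move=> e f eT fT /eqP ef.
  exact: (implyP (forall_inP (forall_inP h4 _ eT) _ fT)).
- exact/forall_inP.
- apply/forall_inP => e eT; apply/forall_inP => f fT.
  by apply/implyP => /eqP ef; apply/eqP/h2.
- exact/forallP.
- apply/forall_inP => e eT; apply/forall_inP => f fT.
  by apply/implyP => /eqP; apply: h4.
Qed.

Lemma connect_arc T e u : e \in T -> connect (arc_rel T) u (tl e) ->
  connect (arc_rel T) u (hd e).
Proof.
move=> eT /connect_trans; apply; apply: connect1.
by apply/existsP; exists e; rewrite eT !eqxx.
Qed.

Lemma connect_arc_ind T u (X : V -> Prop) : X u ->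
  (forall e, e \in T -> X (tl e) -> X (hd e)) ->
  forall v, connect (arc_rel T) u v -> X v.
Proof.
move=> Xu step v /connectP[p pP ->] {v}; elim: p u Xu pP => //= w p IHp u Xu.
case/andP=> /existsP[e /and3P[eT /eqP tu /eqP hw]] /IHp; apply.
by rewrite -hw; apply: step; rewrite ?tu.
Qed.

Lemma last_arc T u v : connect (arc_rel T) u v -> v != u ->
  exists2 e, e \in T & hd e = v.
Proof.
move=> uv; apply: (connect_arc_ind (X := fun v => v != u -> exists2 e, e \in T & hd e = v))
  uv; first by rewrite eqxx.
by move=> e eT _ _; exists e.
Qed.

Lemma diwalk_cat T u p q v :
  reflect (exists2 w, diwalk T u p w & diwalk T w q v) (diwalk T u (p ++ q) v).
Proof.
elim: p u => [|e p IHp] u /=.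
  by apply: (iffP idP) => [?|[w /eqP->]//]; exists u.
apply: (iffP and3P) => [[eT tu /IHp[w pw qv]]|[w /and3P[eT tu pw] qv]].
  by exists w; rewrite ?eT ?tu.
by split=> //; apply/IHp; exists w.
Qed.

Lemma diwalk_rcons T u p e v :
  diwalk T u (rcons p e) v = [&& e \in T, hd e == v & diwalk T u p (tl e)].
Proof.
elim: p u => [|f p IHp] u /=; first by rewrite [tl e == u]eq_sym; case: (e \in T); rewrite //= andbC.
by rewrite IHp; case: (f \in T); case: (_ == u); case: (e \in T); case: (_ == v).
Qed.

Lemma diwalk_connect T u p v : diwalk T u p v -> connect (arc_rel T) u v.
Proof.
elim/last_ind: p v => [|p e IHp] v; first by move=> /= /eqP->.
by rewrite diwalk_rcons => /and3P[eT /eqP<- /IHp]; apply: connect_arc.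
Qed.

Lemma connect_diwalk T u v : connect (arc_rel T) u v -> exists p, diwalk T u p v.
Proof.
apply: (connect_arc_ind (X := fun v => exists p, diwalk T u p v)).
  by exists [::] => /=.
move=> e eT [p pe]; by exists (rcons p e); rewrite diwalk_rcons eT eqxx.
Qed.

(** A walk that returns to its start or repeats a head is shortened by cutting out the closed part;
    induction on the length. *)
Lemma connect_dipath T u v : connect (arc_rel T) u v -> exists p, dipath T u p v.
Proof.
case/connect_diwalk => p; have [n] := ubnP (size p).
elim: n p => // n IHn p /ltnSE szp pw.
case: (boolP (dipath T u p v)) => [?|]; first by exists p.
rewrite /dipath pw /=; case: (boolP (u \in _)) => [/mapP[e ep ue] _|uN].
  case/splitPr: ep szp pw => p1 p2 szp /diwalk_cat[w _ /= /and3P[_ _ p2w]].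
  apply: (IHn p2); last by rewrite ue.
  by move: szp; rewrite size_cat /= addnS => /(leq_trans _); apply; rewrite ltnS leq_addl.
move=> /= /uniqPn - /(_ u)[i [j [lij]]]; rewrite size_map => jp.
have ip := ltn_trans lij jp; have e0 : A by case: p ip {szp pw uN lij jp}.
rewrite !(nth_map e0) // => hij.
have walk_take k : k < size p -> diwalk T u (take k.+1 p) (hd (nth e0 p k)) /\
   diwalk T (hd (nth e0 p k)) (drop k.+1 p) v.
  move=> kp; move: pw; rewrite -{1}(cat_take_drop k.+1 p) => /diwalk_cat[w].
  rewrite (take_nth e0) // diwalk_rcons => /and3P[h1 /eqP<- h2] h3.
  by rewrite diwalk_rcons h1 h2 eqxx.
apply: (IHn (take i.+1 p ++ drop j.+1 p)); last first.
  apply/diwalk_cat; exists (hd (nth e0 p i)); first by case: (walk_take i ip).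
  by rewrite hij; case: (walk_take j jp).
rewrite size_cat size_takel // size_drop; lia.
Qed.

(** By acyclicity no arc [e] has a walk from its head back to its tail. Hence no arc enters [r],
    paths to tails extend to paths to heads, and two consecutive arcs form a directed path, to which
    the time condition applies. *)
Lemma rooted_arborescence_tra r T : rooted_arborescence r T ->
  (forall u v p, dipath T u p v -> time_respecting_path lam p) -> tra r T.
Proof.
case=> acy ex1 tr.
have conn v : connect (arc_rel T) r v.
  by case: (ex1 v) => p [/andP[/diwalk_connect]].
have noloop e : e \in T -> tl e != hd e.
  move=> eT; apply/negP => /eqP th; have := acy (tl e) [:: e].
  by rewrite /dicycle /= eT eqxx th eqxx.
have nocycle e : e \in T -> ~~ connect (arc_rel T) (hd e) (tl e).
  move=> eT; apply/negP => /connect_dipath[p /andP[pw pu]].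
  have := acy (tl e) (e :: p); rewrite /dicycle /= eT eqxx pw /=.
  by move: pu; rewrite cons_uniq => ->.
apply/traP; split=> //.
- move=> e eT; apply/negP => /eqP he; move: (nocycle e eT).
  by rewrite he conn.
- have paths e : e \in T -> exists p, dipath T r (rcons p e) (hd e).
    move=> eT; case: (connect_dipath (conn (tl e))) => p /andP[pw pu].
    exists p; rewrite /dipath diwalk_rcons eT eqxx pw.
    rewrite map_rcons -rcons_cons rcons_uniq pu !andbT andTb.
    apply/negP => /predU1P[he|/mapP[f fp he]].
      by move: (nocycle e eT); rewrite he conn.
    move: (nocycle e eT); rewrite he.
    case/splitPr: fp pw {pu} => p1 p2 /diwalk_cat[w _ /= /and3P[_ _ /diwalk_connect->]].
    by [].
  (* Paths ending with [e] and with [f] have the same end, so they coincide, and so do their last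
     arcs. *)
  move=> e f eT fT hef; case: (paths _ eT) => p pP; case: (paths _ fT) => q qP.
  case: (ex1 (hd e)) => x [_ xu]; move: qP; rewrite -hef => /xu qx.
  by move: pP => /xu px; move: (etrans (esym px) qx) => /rcons_inj[].
- move=> e f eT fT ef; have := tr (tl e) (hd f) [:: e; f].
  have ef' : tl e != hd f.
    apply/negP => /eqP tf; move: (nocycle e eT).
    by rewrite tf ef (connect_arc fT).
  have hef : hd e != hd f by rewrite ef noloop.
  rewrite /dipath /= eT fT ef !eqxx /= !inE negb_or -ef noloop // ef' hef.
  by rewrite !andbT; apply.
Qed.

(** Read backwards from [v], the walk is forced: at most one arc enters each vertex, and none enters
    [r]. *)
Lemma tra_diwalk_inj r T v p q : tra r T -> diwalk T r p v -> diwalk T r q v -> p = q.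
Proof.
case/traP=> noin inj _ _; elim/last_ind: p v q => [|p e IHp] v q.
  move=> /= /eqP<-; case/lastP: q => // q f.
  by rewrite diwalk_rcons => /and3P[/noin/negPf->].
rewrite diwalk_rcons => /and3P[eT /eqP hv pw].
case/lastP: q => [|q f]; first by move=> /= /eqP vr; move: (noin _ eT); rewrite hv vr eqxx.
rewrite diwalk_rcons => /and3P[fT /eqP hf qw].
have ef : e = f by apply: inj => //; rewrite hv hf.
by rewrite -ef in qw *; rewrite (IHp _ _ pw qw).
Qed.

Lemma tra_time_respecting r T : tra r T -> time_respecting_arborescence lam T.
Proof.
move=> trT; have [noin inj conn time] := traP _ _ trT.
split.
  exists r; split.
    move=> u p; apply/negP => /and3P[p0 pw _].
    case: (connect_diwalk (conn u)) => q qw.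
    (* Appending the closed walk [p] would give a second, longer walk from [r] to [u]. *)
    have qpw : diwalk T r (q ++ p) u by apply/diwalk_cat; exists u.
    move: (congr1 size (tra_diwalk_inj trT qw qpw)).
    rewrite size_cat => /eqP; rewrite -{1}[size q]addn0 eqn_add2l eq_sym size_eq0.
    by rewrite (negPf p0).
  move=> v; case: (connect_dipath (conn v)) => p pP; exists p; split=> // q.
  move: pP => /andP[pw _] /andP[qw _]; exact: tra_diwalk_inj qw.
move=> u v p /andP[+ _]; rewrite /time_respecting_path.
elim: p u => // e [|f p] IHp u //= /andP[eT /andP[_]] pw.
have /= -> := IHp (hd e) pw; rewrite andbT.
by case/and3P: pw => fT /eqP tf _; apply: time.
Qed.

Lemma time_respecting_arborescenceE T :
  time_respecting_arborescence lam T <-> exists r, tra r T.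
Proof.
split=> [[[r rT] tr]|[r /tra_time_respecting//]].
by exists r; apply: rooted_arborescence_tra.
Qed.

Definition prec : rel A := [rel e f | (hd e == tl f) && (lam e <= lam f)%R].

(** * Earliest-arrival arborescences *)

Section EarliestArrival.

Variables (r : V) (init : pred A).
Hypothesis init_tl : forall e, init e -> tl e = r.

Definition arrival_step (X : {set A}) : {set A} :=
  [set f | init f || [exists e in X, prec e f]].

Lemma arrival_step_mono : {homo arrival_step : X Y / X \subset Y}.
Proof.
move=> X Y /subsetP XY; apply/subsetP => f; rewrite !inE.
case/orP=> [->//|/exists_inP[e eX ef]]; apply/orP; right.
by apply/exists_inP; exists e => //; apply: XY.
Qed.

(** The arcs in which time-respecting walks that start in [init] can end. As a least fixpoint it
    also assigns to each arc the round of its first appearance. *)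
Definition arriving := fixset arrival_step.

Lemma init_arriving f : init f -> f \in arriving.
Proof.
by move=> fi; rewrite /arriving -(fixsetK arrival_step_mono) inE fi.
Qed.

Lemma prec_arriving e f : e \in arriving -> prec e f -> f \in arriving.
Proof.
move=> ea ef; rewrite /arriving -(fixsetK arrival_step_mono) inE.
by apply/orP; right; apply/exists_inP; exists e.
Qed.

Lemma arriving_connect e f : e \in arriving -> connect prec e f -> f \in arriving.
Proof.
move=> ea /connectP[p pP ->]; elim: p e ea pP => //= g p IHp e ea /andP[eg].
exact: (IHp g (prec_arriving ea eg)).
Qed.

Local Notation ord := (fix_order arrival_step).

Lemma arrivingP f : f \in arriving ->
  init f \/ exists e, [/\ e \in arriving, prec e f & ord e < ord f].
Proof.
move=> fa; have := in_iter_fix_orderE arrival_step f; rewrite fa.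
case En: (ord f) => [|n] /=; first by rewrite inE.
rewrite inE => /orP[|/exists_inP[e en ef]]; first by left.
right; exists e; split=> //.
  exact: (subsetP (iter_sub_fix arrival_step_mono n)).
by rewrite ltnS; apply: (fix_order_small arrival_step_mono).
Qed.

(* Breaking ties by the round of arrival excludes cycles of arcs with equal labels. *)
Definition arrival_key f : rat *l nat := (lam f, ord f).

Lemma arrival_key_lam e f : (arrival_key e <= arrival_key f)%O -> (lam e <= lam f)%R.
Proof. by rewrite lexi_pair => /andP[]. Qed.

Lemma arrival_key_lt e f : (lam e <= lam f)%R -> ord e < ord f ->
  (arrival_key e < arrival_key f)%O.
Proof. by move=> h1 h2; rewrite ltxi_pair h1 ltEnat /= h2 implybT. Qed.

Hypothesis arriving_all :
  forall v, v != r -> exists2 f, f \in arriving & hd f = v.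

(** For each vertex other than [r], an arriving arc of least [arrival_key] into it is chosen. Along
    the chosen arcs the key strictly increases, which gives both reachability from [r] and the time
    condition. *)
Lemma earliest_arborescence : exists T,
  [/\ tra r T, {subset T <= arriving} &
      forall f g, f \in T -> g \in arriving -> hd g = hd f -> (lam f <= lam g)%R].
Proof.
pose best v (o : option A) := if o is Some f then
   [/\ f \in arriving, hd f = v & forall g, g \in arriving -> hd g = v ->
        (arrival_key f <= arrival_key g)%O] else v = r.
have /fin_all_exists[inn innP] : forall v, exists o, best v o.
  move=> v; have [->|/arriving_all[f0 f0a f0v]] := eqVneq v r; first by exists None.
  pose Q := [pred f | (f \in arriving) && (hd f == v)].
  have Q0 : Q f0 by rewrite /= f0a f0v eqxx.
  exists (Some [arg min_(f < f0 | Q f) arrival_key f]%O).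
  case: arg_minP => //= f /andP[fa /eqP fv] fmin; split=> // g ga /eqP gv.
  by apply: fmin; rewrite /= ga gv.
pose T := [set f | (hd f != r) && (inn (hd f) == Some f)].
have inT f : f \in T -> [/\ f \in arriving, hd f != r &
    forall g, g \in arriving -> hd g = hd f -> (arrival_key f <= arrival_key g)%O].
  by rewrite inE => /andP[fr /eqP If]; move: (innP (hd f)); rewrite If => -[].
have exT v : v != r -> exists2 f, f \in T & hd f = v.
  move=> vr; move: (innP v); case Ev: (inn v) => [f|] /=; last by move/eqP: vr.
  by case=> fa fv _; exists f => //; rewrite inE fv vr Ev eqxx.
(* A predecessor [e] of [f] from an earlier round has a smaller key than [f], and the arc chosen
   into the tail of [f] has a key no larger than that of [e]. *)
have prevT f : f \in T -> tl f = r \/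
    exists e, [/\ e \in T, hd e = tl f & (arrival_key e < arrival_key f)%O].
  move=> fT; case: (inT f fT) => fa _ _.
  have [/init_tl|[e [ea /andP[/eqP ef lef] oef]]] := arrivingP fa; first by left.
  have [?|/exT[g gT gv]] := eqVneq (tl f) r; [by left|right].
  exists g; split=> //; case: (inT g gT) => _ _ gmin.
  by apply: (le_lt_trans (gmin e ea _)); rewrite ?gv //; apply: arrival_key_lt.
exists T; split.
- apply/traP; split=> [f /inT[]//|e f| |e f eT fT ef].
  + by rewrite !inE => /andP[_ /eqP ie] /andP[_ /eqP jf] ef; move: ie; rewrite ef jf => -[].
  + move=> v; apply/negPn/negP => nv.
    have vr : v != r by apply: contraNneq nv => ->.
    have [f0 f0T f0v] := exT v vr.
    (* Among the chosen arcs with unreachable heads take one of least key; by [prevT] its tail is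
       reachable. *)
    pose Q := [pred f | (f \in T) && ~~ connect (arc_rel T) r (hd f)].
    have Q0 : Q f0 by rewrite /= f0T f0v.
    case: (arg_minP arrival_key Q0) => f /andP[fT nf] fmin.
    case/negP: nf; apply: connect_arc => //.
    case: (prevT f fT) => [->//|[e [eT ef lef]]].
    rewrite -ef; apply: contraLR lef => ne; rewrite -leNgt.
    by apply: fmin; rewrite /= eT.
  + case: (prevT f fT) => [fr|[g [gT gf /ltW/arrival_key_lam glf]]].
      by case: (inT e eT); rewrite ef fr eqxx.
    have -> // : e = g.
    move: eT gT; rewrite !inE ef -gf => /andP[_ /eqP ->] /andP[_ /eqP[]] //.
- by move=> f /inT[].
- by move=> f g /inT[_ _ fmin] ga gf; apply/arrival_key_lam/fmin.
Qed.

End EarliestArrival.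

(** * Exchanges that keep the root *)

Definition swap T T' := #|T :\: T'| = 1 /\ #|T' :\: T| = 1.

Lemma swap_sym T T' : swap T T' -> swap T' T.
Proof. by case. Qed.

Lemma swap_exchange T e f : f \in T -> e \notin T -> swap T (e |: T :\ f).
Proof.
move=> fT eT; have ef : e != f by apply: contraNneq eT => ->.
split; apply/eqP/cards1P; [exists f | exists e];
  apply/setP => g; rewrite !inE.
  have [->|gf] := eqVneq g f; first by rewrite fT [f == e]eq_sym (negPf ef) /=.
  by case: (g \in T); rewrite ?orbT ?andbF.
by have [->|ge] := eqVneq g e; rewrite /= ?eT //; case: (g \in T); rewrite ?andbF.
Qed.

Inductive reach T : {set A} -> Prop :=
| reach_refl r : tra r T -> reach T T
| reach_step T' T'' r : reach T T' -> tra r T'' -> swap T' T'' -> reach T T''.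

Lemma reach_trans T T' T'' : reach T T' -> reach T' T'' -> reach T T''.
Proof.
by move=> h; elim=> // S S' r _ hS tS sS; apply: reach_step tS sS.
Qed.

Lemma reach_sym T T' : reach T T' -> reach T' T.
Proof.
have tra1 S S' : reach S S' -> exists r, tra r S'.
  by case=> [r|S1 S2 r _]; exists r.
elim=> [r tT|T1 T2 r h12 h21 t2 s12]; first exact: reach_refl tT.
case: (tra1 _ _ h12) => r1 t1.
exact: (reach_trans (reach_step (reach_refl t2) t1 (swap_sym s12)) h21).
Qed.

Lemma reach_reconfiguration T T' : reach T T' <->
  exists l Ts, reconfiguration_sequence lam T T' l Ts.
Proof.
split.
  elim=> [r tT|T1 T2 r _ [l [Ts [Ts0 Tsl traTs swapTs]]] t2 s12].
    exists 0, (fun=> T); split=> // i _; exact: tra_time_respecting tT.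
  exists l.+1, (fun i => if i <= l then Ts i else T2); split=> //.
  - by rewrite ltnn.
  - by move=> i _; case: leqP => [/traTs//|_]; apply: tra_time_respecting t2.
  - move=> i; rewrite ltnS => il; rewrite il; case: ltnP => [/swapTs//|li].
    have -> : i = l by apply/eqP; rewrite eqn_leq il.
    by rewrite Tsl.
case=> l [Ts [<- <- traTs swapTs]].
have {}traTs i : i <= l -> exists r, tra r (Ts i).
  by move/traTs/time_respecting_arborescenceE.
suff : forall i, i <= l -> reach (Ts 0) (Ts i) by apply.
elim=> [|i IHi] il.
  by case: (traTs 0 il) => r; apply: reach_refl.
case: (traTs _ il) => r tr; exact: (reach_step (IHi (ltnW il)) tr (swapTs i il)).
Qed.

Lemma in_arc r T v : tra r T -> v != r -> exists2 e, e \in T & hd e = v.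
Proof. by case/traP=> _ _ conn _; apply: last_arc. Qed.

(** Induction from the root: an arc at [r] is in [init], and any other arc is preceded by the arc of
    [T] into its tail. *)
Lemma tra_arriving r (init : pred A) T : tra r T ->
  (forall e, e \in T -> tl e = r -> init e) -> {subset T <= arriving init}.
Proof.
move=> trT initT; have [noin inj conn time] := traP _ _ trT.
suff into v : connect (arc_rel T) r v -> forall e, e \in T -> hd e = v -> e \in arriving init.
  by move=> e eT; apply: (into (hd e)).
apply: (connect_arc_ind (X := fun v => forall e, e \in T -> hd e = v -> e \in arriving init)).
  by move=> e /noin /eqP.
move=> e eT IHe f fT fe; rewrite (inj f e fT eT fe) {f fT fe}.
have [te|/(in_arc trT)[g gT gv]] := eqVneq (tl e) r; first exact: (init_arriving (initT _ eT te)).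
apply: prec_arriving (IHe g gT gv) _; rewrite /prec /= gv eqxx /=.
exact: time.
Qed.

Lemma tra_sub_eq r T T' : tra r T -> tra r T' -> T' \subset T -> T = T'.
Proof.
move=> trT trT' sub; apply/eqP; rewrite eqEsubset sub andbT; apply/subsetP => e eT.
have [noin inj _ _] := traP _ _ trT.
case: (in_arc trT' (noin e eT)) => f fT' fe.
by rewrite (inj e f) // (subsetP sub).
Qed.

(** Induction on the number of arcs of [T0] missing from [T]: each exchange brings in such an arc
    and removes an arc outside [T0]. *)
Lemma reach_earliest r T T0 : tra r T -> tra r T0 ->
  (forall f g T', tra r T' -> f \in T0 -> g \in T' -> hd g = hd f -> (lam f <= lam g)%R) ->
  reach T T0.
Proof.
move=> + tr0 early; have [noin0 inj0 conn0 time0] := traP _ _ tr0.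
have [n] := ubnP #|T0 :\: T|; elim: n T => // n IHn T /ltnSE szn trT.
have [noin inj conn time] := traP _ _ trT.
case: (boolP (T0 \subset T)) => [sub|/subsetPn[g g0 gT]].
  by rewrite (tra_sub_eq trT tr0 sub); apply: reach_refl tr0.
(* Follow [T0] from [r] to the tail of [g]: the first arc outside [T] will do, or [g] itself if
   there is none. *)
have [e [e0 eT ce]] : exists e, [/\ e \in T0, e \notin T & connect (arc_rel (T :&: T0)) r (tl e)].
  suff : connect (arc_rel (T :&: T0)) r (tl g) \/
      exists e, [/\ e \in T0, e \notin T & connect (arc_rel (T :&: T0)) r (tl e)].
    by case=> [cg|//]; exists g.
  apply: (connect_arc_ind (X := fun v => connect (arc_rel (T :&: T0)) r v \/
      exists e, [/\ e \in T0, e \notin T & connect (arc_rel (T :&: T0)) r (tl e)])) (conn0 (tl g)).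
    by left.
  move=> e e0 [ce|]; last by right.
  case: (boolP (e \in T)) => eT; last by right; exists e.
  by left; apply: connect_arc => //; rewrite inE eT.
have [f fT fe] := in_arc trT (noin0 e e0).
have fT0 : f \notin T0.
  by apply: contra eT => f0; rewrite -(inj0 f e f0 e0 fe).
pose T1 := e |: T :\ f.
have sub1 : T :&: T0 \subset T1.
  apply/subsetP => h; rewrite !inE => /andP[hT h0]; rewrite hT andbT.
  by apply/orP; right; apply: contraNneq fT0 => <-.
have in1 h : h \in T1 -> h = e \/ [/\ h \in T, h != f & hd h != hd e].
  rewrite !inE => /orP[/eqP|/andP[hf hT]]; [by left|right]; split=> //.
  by rewrite -fe; apply: contra hf => /eqP/(inj _ _ hT fT) ->.
have tr1 : tra r T1.
  have conn1 v : connect (arc_rel (T :&: T0)) r v -> connect (arc_rel T1) r v.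
    apply: (connect_arc_ind (X := connect (arc_rel T1) r)) => // h /(subsetP sub1).
    exact: connect_arc.
  have conne : connect (arc_rel T1) r (hd e).
    by apply: connect_arc (conn1 _ ce); rewrite !inE eqxx.
  apply/traP; split.
  - by move=> h /in1[->|[/noin]//]; apply: noin0.
  - move=> a b /in1[->|[aT af ae]] /in1[->|[bT bf be]] //; last exact: inj.
      by move=> ab; rewrite ab eqxx in be.
    by move=> ab; rewrite ab eqxx in ae.
  - move=> v; apply: (connect_arc_ind (X := connect (arc_rel T1) r)) (conn v) => // h hT.
    have [->|hf] := eqVneq h f; first by rewrite fe.
    by apply: connect_arc; rewrite !inE hf hT orbT.
  (* An arc after [e] used to follow [f], and [e] is no later than [f]. An arc before [e] ends the
     walk to its tail inside the common part, so it belongs to [T0] together with [e]. *)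
  - move=> a b /in1[->|[aT af ae]] /in1[->|[bT bf be]] //; last exact: time.
      move=> eb; apply: (le_trans (early e f T trT e0 fT fe)).
      by apply: time => //; rewrite fe.
    move=> ab; have tr : tl e != r by rewrite -ab noin.
    case: (last_arc ce tr) => h; rewrite inE => /andP[hT h0] hab.
    have <- : h = a by apply: inj => //; rewrite hab.
    exact: time0.
apply: (reach_trans (reach_step (reach_refl trT) tr1 (swap_exchange fT eT))).
apply: IHn tr1; apply: leq_trans szn; apply: proper_card; apply/properP; split.
  apply/subsetP => h; rewrite !inE negb_or negb_and => /andP[/andP[_ hf] h0].
  rewrite h0 andbT; case/orP: hf => // /negPn/eqP hf.
  by rewrite hf (negPf fT0) in h0.
by exists e; rewrite !inE ?eT ?e0 // eqxx.
Qed.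

(** Both reach the same earliest-arrival arborescence, built with all arcs leaving [r] as possible
    starts. *)
Lemma reach_same_root r T T' : tra r T -> tra r T' -> reach T T'.
Proof.
pose init : pred A := fun e => tl e == r.
have arr S : tra r S -> {subset S <= arriving init}.
  by move=> trS; apply: (tra_arriving trS) => e _ /eqP.
move=> trT trT'; have [T0 [tr0 _ early]] : exists T, [/\ tra r T, {subset T <= arriving init} &
      forall f g, f \in T -> g \in arriving init -> hd g = hd f -> (lam f <= lam g)%R].
  apply: earliest_arborescence => [e /eqP//|v vr].
  by case: (in_arc trT vr) => e eT ev; exists e => //; apply: arr eT.
have toT0 S : tra r S -> reach S T0.
  move=> trS; apply: (reach_earliest trS tr0) => f g S' trS' f0 gS'.
  by apply: early => //; apply: arr gS'.
exact: (reach_trans (toT0 T trT) (reach_sym (toT0 T' trT'))).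
Qed.

(** * Full arcs and changes of the root *)

Definition full e := [forall v, exists f, connect prec e f && (hd f == v)].

Lemma fullP e : reflect (forall v, exists2 f, connect prec e f & hd f = v) (full e).
Proof.
apply: (iffP forallP) => h v.
  by case/existsP: (h v) => f /andP[ef /eqP]; exists f.
by case: (h v) => f ef fv; apply/existsP; exists f; rewrite ef fv eqxx.
Qed.

Lemma prec_full e f : prec e f -> full f -> full e.
Proof.
move=> ef /fullP fF; apply/fullP => v; case: (fF v) => g fg gv; exists g => //.
exact: connect_trans (connect1 ef) fg.
Qed.

(** Walks are started with the successors of [e], so every arc of [T] is no earlier than [e] and [e]
    can be placed above the old root. The alternative [tl e = hd e] covers loops, where the root
    does not change. *)
Lemma full_swap e : full e -> exists T T',
  [/\ tra (hd e) T, tra (tl e) T' & tl e = hd e \/ swap T T'].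
Proof.
move/fullP=> eF; pose init : pred A := prec e.
have init_tl f : init f -> tl f = hd e by case/andP=> /eqP.
have arr f : connect prec e f -> f = e \/ f \in arriving init.
  case/connectP=> -[|g p] /=; [by move=> _ ->; left|case/andP=> eg gp ->; right].
  by apply: (arriving_connect (init_arriving eg)); apply/connectP; exists p.
have lam_arr f : f \in arriving init -> (lam e <= lam f)%R.
  rewrite /arriving /fixset; move: #|_| => n; elim: n f => [|n IHn] f /=; first by rewrite inE.
  rewrite inE => /orP[/andP[]//|/exists_inP[g gn /andP[_]]]; apply: le_trans.
  exact: IHn.
have [v vr|T [trT subT _]] := earliest_arborescence init_tl.
  case: (eF v) => f /arr[->|fa] fv; last by exists f.
  by rewrite fv eqxx in vr.
have [noin inj conn time] := traP _ _ trT.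
have [te|te] := eqVneq (tl e) (hd e).
  by exists T, T; split; rewrite ?te //; left.
have [f fT fe] := in_arc trT te.
have eT : e \notin T by apply/negP => /noin; rewrite eqxx.
exists T, (e |: T :\ f); split=> //; last by right; apply: swap_exchange.
have in1 h : h \in e |: T :\ f -> h = e \/ [/\ h \in T, h != f & hd h != tl e].
  rewrite !inE => /orP[/eqP|/andP[hf hT]]; [by left|right]; split=> //.
  by rewrite -fe; apply: contra hf => /eqP/(inj _ _ hT fT) ->.
apply/traP; split.
- by move=> h /in1[->|[]//]; rewrite eq_sym.
- move=> a b /in1[->|[aT af ae]] /in1[->|[bT bf be]] //; last exact: inj.
    by move=> ab; move: (noin b bT); rewrite -ab eqxx.
  by move=> ab; move: (noin a aT); rewrite ab eqxx.
- move=> v; apply: (connect_arc_ind (X := connect (arc_rel (e |: T :\ f)) (tl e))) (conn v).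
    by apply: connect_arc (connect0 _ _); rewrite !inE eqxx.
  move=> h hT; have [->|hf] := eqVneq h f; first by rewrite fe.
  by apply: connect_arc; rewrite ?inE ?hf ?hT ?orbT.
(* No arc comes before [e]: the only arc of [T] into its tail was [f]. *)
- move=> a b /in1[->|[aT af ae]] /in1[->|[bT bf be]] //; last exact: time.
    by move=> _; apply/lam_arr/subT.
  by move=> ab; rewrite ab eqxx in ae.
Qed.

Definition root_rel : rel V :=
  [rel u v | [exists e, full e && ((tl e == u) && (hd e == v) || (tl e == v) && (hd e == u))]].

Lemma root_rel_sym : symmetric root_rel.
Proof. by move=> u v; apply: eq_existsb => e; rewrite [in RHS]orbC. Qed.

Lemma full_root_rel e : full e -> root_rel (tl e) (hd e).
Proof. by move=> eF; apply/existsP; exists e; rewrite eF !eqxx. Qed.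

(** Each full arc on the path moves the root once, after a rearrangement at the current root into
    the arborescence that [full_swap] supplies. *)
Lemma connect_root_reach r r' T T' : tra r T -> tra r' T' ->
  connect root_rel r r' -> reach T T'.
Proof.
move=> trT + /connectP[p]; elim: p r T trT T' => [|v p IHp] r T trT T' trT' /=.
  by move=> _ rr'; rewrite -rr' in trT *; apply: reach_same_root trT'.
case/andP=> /existsP[e /andP[/full_swap[S [S' [trS trS' swS]]] ends]] pP r'E.
have SS' : reach S S'.
  case: swS => [te|]; last exact: reach_step (reach_refl trS) trS'.
  by apply: reach_same_root trS _; rewrite -te.
case/orP: ends => /andP[/eqP tE /eqP hE]; rewrite tE hE in trS trS'.
  apply: (reach_trans (reach_same_root trT trS')).
  by apply: (reach_trans (reach_sym SS')); apply: IHp pP r'E.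
apply: (reach_trans (reach_same_root trT trS)).
by apply: (reach_trans SS'); apply: IHp pP r'E.
Qed.

(** Fullness passes from [e] back to every arc on the path of [T] from [r], since each arc there
    precedes the next. *)
Lemma tra_full_connect r T e : tra r T -> e \in T -> full e ->
  connect root_rel r (hd e).
Proof.
move=> trT eT; have [noin inj conn time] := traP _ _ trT.
case: (connect_diwalk (conn (tl e))) => p.
elim/last_ind: p e eT => [|p f IHp] e eT.
  by move=> /= /eqP -> /full_root_rel/connect1.
rewrite diwalk_rcons => /and3P[fT /eqP fe pw] eF.
apply: connect_trans (connect1 (full_root_rel eF)); rewrite -fe.
by apply: IHp => //; apply: prec_full eF; rewrite /prec /= fe eqxx time.
Qed.

Lemma swap_root_rel r r' T T' : tra r T -> tra r' T' -> swap T T' ->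
  connect root_rel r r'.
Proof.
(* [root_rel] is symmetric, so the two arborescences may be exchanged to make the entering arc no
   later than the leaving one. *)
wlog suff gen : r r' T T' / forall e f, tra r T -> tra r' T' ->
    r != r' -> T' :\: T = [set e] -> T :\: T' = [set f] -> (lam e <= lam f)%R ->
    connect root_rel r' r.
  move=> trT trT' [/eqP/cards1P[f fE] /eqP/cards1P[e eE]].
  have [->//|rr'] := eqVneq r r'.
  have /orP[ef|fe] := le_total (lam e) (lam f).
    rewrite (sym_connect_sym root_rel_sym); exact: gen trT trT' rr' eE fE ef.
  by apply: gen trT' trT _ fE eE fe; rewrite eq_sym.
move=> e f trT trT' rr' eE fE ef.
have [noin inj conn time] := traP _ _ trT; have [noin' inj' conn' time'] := traP _ _ trT'.
have inTT' g : g \in T' -> g = e \/ g \in T.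
  case: (boolP (g \in T)) => gT gT'; [by right|left].
  by apply/set1P; rewrite -eE inE gT.
have inT'T g : g \in T -> g = f \/ g \in T'.
  case: (boolP (g \in T')) => gT' gT; [by right|left].
  by apply/set1P; rewrite -fE inE gT'.
(* Some arc of [T'] enters [r]; as no arc of [T] does, it is [e]. *)
have he : hd e = r.
  case: (in_arc trT' rr') => g gT' gr; case: (inTT' g gT') => [<-//|/noin].
  by rewrite gr eqxx.
have eT' : e \in T' by have := set11 e; rewrite -eE inE => /andP[].
(* An arc of [T] at [r] is either [f], which is no earlier than [e], or an arc of [T'], where it
   follows [e]. *)
have prece v : connect (arc_rel T) r v -> forall g, g \in T -> hd g = v -> connect prec e g.
  apply: (connect_arc_ind (X := fun v => forall g, g \in T -> hd g = v -> connect prec e g)).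
    by move=> g /noin /eqP.
  move=> g gT IHg h hT hg; rewrite (inj h g hT gT hg) {h hT hg}.
  have [tg|tg] := eqVneq (tl g) r.
    apply: connect1; rewrite /prec /= he tg eqxx /=.
    by case: (inT'T g gT) => [->//|gT']; apply: time' => //; rewrite he.
  case: (in_arc trT tg) => h hT hg; apply: connect_trans (IHg h hT hg) (connect1 _).
  by rewrite /prec /= hg eqxx time.
rewrite -he; apply: (tra_full_connect trT' eT'); apply/fullP => v.
have [->|vr] := eqVneq v r; first by exists e.
by case: (in_arc trT vr) => g gT gv; exists g => //; apply: (prece v).
Qed.

Lemma reach_connect_root r r' T T' : tra r T -> tra r' T' ->
  reach T T' <-> connect root_rel r r'.
Proof.
move=> trT trT'; split; last exact: connect_root_reach trT'.
have uniq_root r1 r2 S : tra r1 S -> tra r2 S -> r1 = r2.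
  move=> tr1 /traP[noin2 _ _ _]; apply/eqP/negPn/negP; rewrite eq_sym.
  by case/(in_arc tr1) => e /noin2/eqP.
move=> h; elim: h r' trT' => [r1 _|T1 T2 r2 h12 IH _ s12] r' trT'.
  by rewrite (uniq_root _ _ _ trT trT').
have [r1 tr1] : exists r1, tra r1 T1.
  by case: h12 => [r3|S S' r3 _]; exists r3.
exact: connect_trans (IH _ tr1) (swap_root_rel tr1 trT' s12).
Qed.

End TimeRespectingArborescences.

(** * Functions computable in polynomial time *)

Lemma tree_size_gt0 x : 0 < tree_size x.
Proof. by case: x. Qed.

Lemma leq_expl k : {homo expn^~ k : m n / m <= n}.
Proof. by case: k => // k m n; rewrite leq_exp2r. Qed.

(** Since the base exceeds 1, constants, sums and products are absorbed by a larger exponent, and no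
    polynomials have to be manipulated. *)
Definition pbound (h : tree -> nat) : Prop :=
  exists k, forall x, h x <= (tree_size x).+2 ^ k.

Lemma pbound_le g h : (forall x, g x <= h x) -> pbound h -> pbound g.
Proof. by move=> gh [k hk]; exists k => x; apply: leq_trans (hk x). Qed.

Lemma pbound_const n : pbound (fun=> n).
Proof.
exists n => x; apply: leq_trans (ltnW (ltn_expl n (isT : 1 < 2))) _.
exact: leq_expl.
Qed.

Lemma pbound_size : pbound tree_size.
Proof. by exists 1 => x; rewrite expn1; lia. Qed.

Lemma pboundM g h : pbound g -> pbound h -> pbound (fun x => g x * h x).
Proof.
by move=> [i gi] [j hj]; exists (i + j) => x; rewrite expnD leq_mul.
Qed.

Lemma pboundD g h : pbound g -> pbound h -> pbound (fun x => g x + h x).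
Proof.
move=> [i gi] [j hj]; exists (maxn i j).+1 => x; rewrite expnS.
apply: (@leq_trans (2 * (tree_size x).+2 ^ maxn i j)); last by rewrite leq_mul2r orbC.
rewrite mul2n -addnn; apply: leq_add.
  by apply: leq_trans (gi x) _; rewrite leq_exp2l // leq_maxl.
by apply: leq_trans (hj x) _; rewrite leq_exp2l // leq_maxr.
Qed.

Lemma pbound_comp h (f : tree -> tree) :
  pbound h -> pbound (fun x => tree_size (f x)) -> pbound (fun x => h (f x)).
Proof.
move=> [i hi] [j fj]; exists (j.+1 * i) => x; apply: leq_trans (hi _) _.
(* The base is at least 3, because trees have positive size; so adding 2 to a power of it is covered
   by one more factor. *)
rewrite expnM; apply: leq_expl; rewrite expnS; have := fj x.
have: 0 < (tree_size x).+2 ^ j by rewrite expn_gt0.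
have := tree_size_gt0 x; move: (_ ^ j) => m; nia.
Qed.

(** * Programs and their closure properties *)

Fixpoint reloc (g : nat -> nat) (e : expr) : expr :=
  match e with
  | EVar i => EVar i
  | ENil => ENil
  | ECons e1 e2 => ECons (reloc g e1) (reloc g e2)
  | EHd e1 => EHd (reloc g e1)
  | ETl e1 => ETl (reloc g e1)
  | EIf e1 e2 e3 => EIf (reloc g e1) (reloc g e2) (reloc g e3)
  | ELet e1 e2 => ELet (reloc g e1) (reloc g e2)
  | ECall f e1 => ECall (g f) (reloc g e1)
  end.

Definition embeds (F G : seq expr) (g : nat -> nat) : Prop :=
  forall f, nth ENil G (g f) = reloc g (nth ENil F f).

Lemma eval_reloc F G g env e v t :
  embeds F G g -> eval F env e v t -> eval G env (reloc g e) v t.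
Proof.
move=> FG; elim=> {env e v t} /=; intros; try by econstructor; eauto.
by apply: EvalCall; rewrite ?FG; eauto.
Qed.

(** Time and output size share one bound: the cost of a composite depends on the size of the
    intermediate result. *)
Definition runs (F : seq expr) (i : nat) (f : tree -> tree) (h : tree -> nat) : Prop :=
  forall x, exists2 t, eval F [:: x] (nth ENil F i) (f x) t &
    t + tree_size (f x) <= h x.

Lemma runs_reloc F G g i f h : embeds F G g -> runs F i f h -> runs G (g i) f h.
Proof.
move=> FG Ff x; case: (Ff x) => t ev le_t; exists t => //.
by rewrite FG; apply: eval_reloc ev.
Qed.

Definition ptime (f : tree -> tree) : Prop :=
  exists F i h, pbound h /\ runs F i f h.

(* The first n entries of the table are left free for new, possibly recursive, bodies. *)
Lemma ptime_merge f1 f2 n : ptime f1 -> ptime f2 ->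
  exists G i1 i2 h1 h2, [/\ pbound h1, pbound h2 &
    forall E, size E = n -> runs (E ++ G) i1 f1 h1 /\ runs (E ++ G) i2 f2 h2].
Proof.
case=> F1 [i1 [h1 [b1 r1]]] [F2 [i2 [h2 [b2 r2]]]].
(* Calls of undefined functions return Leaf, and must still be undefined after renaming. *)
pose N := n + (size F1 + size F2).
pose g1 f := if f < size F1 then n + f else N.
pose g2 f := if f < size F2 then n + (size F1 + f) else N.
exists (map (reloc g1) F1 ++ map (reloc g2) F2), (g1 i1), (g2 i2), h1, h2.
split=> // E szE; split; [apply: runs_reloc r1 | apply: runs_reloc r2] => f.
  rewrite /g1; case: ltnP => hf.
    by rewrite nth_cat szE ltnNge leq_addr /= addKn nth_cat size_map hf (nth_map ENil).
  by rewrite !nth_default // !size_cat !size_map szE.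
rewrite /g2; case: ltnP => hf; last by rewrite !nth_default // !size_cat !size_map szE.
rewrite nth_cat szE ltnNge leq_addr /= addKn nth_cat size_map ltnNge leq_addr /=.
by rewrite addKn (nth_map ENil).
Qed.

Lemma ptime_size f : ptime f -> pbound (fun x => tree_size (f x)).
Proof.
case=> F [i [h [hb Ff]]]; apply: pbound_le hb => x.
by case: (Ff x) => t _; apply: leq_trans (leq_addl _ _).
Qed.

Lemma ptime_ext f g : f =1 g -> ptime f -> ptime g.
Proof.
move=> fg [F [i [h [hb Ff]]]]; exists F, i, h; split=> // x.
by case: (Ff x) => t; rewrite fg; exists t.
Qed.

Lemma ptime_id : ptime (fun x => x).
Proof.
exists [:: EVar 0], 0, (fun x => 1 + tree_size x); split.
  exact: pboundD (pbound_const _) pbound_size.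
by move=> x; exists 1 => //; apply: (EvalVar _ [:: x] 0).
Qed.

Lemma ptime_leaf : ptime (fun=> Leaf).
Proof.
exists [:: ENil], 0, (fun x => 2); split; first exact: pbound_const.
by move=> x; exists 1 => //; apply: EvalNil.
Qed.

Lemma ptime_comp f g : ptime f -> ptime g -> ptime (fun x => g (f x)).
Proof.
move=> pf pg; case: (ptime_merge 1 pf pg) => G [i [j [h [k [hb kb GP]]]]].
pose F := ECall j (ECall i (EVar 0)) :: G.
have [Ff Fg] := GP [:: ECall j (ECall i (EVar 0))] erefl.
exists F, 0, (fun x => 3 + (h x + k (f x))); split.
  apply: pboundD (pbound_const 3) (pboundD hb (pbound_comp kb _)).
  exact: ptime_size.
move=> x; case: (Ff x) => t evf ht; case: (Fg (f x)) => t' evg ht'.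
exists ((1 + t).+1 + t').+1; last by lia.
exact: (EvalCall (EvalCall (EvalVar _ [:: x] 0) evf) evg).
Qed.

Lemma ptime_node f g : ptime f -> ptime g -> ptime (fun x => Node (f x) (g x)).
Proof.
move=> pf pg; case: (ptime_merge 1 pf pg) => G [i [j [h [k [hb kb GP]]]]].
pose e := ECons (ECall i (EVar 0)) (ECall j (EVar 0)).
have [Ff Fg] := GP [:: e] erefl.
exists (e :: G), 0, (fun x => 6 + (h x + k x)); split.
  exact: pboundD (pbound_const 6) (pboundD hb kb).
move=> x; case: (Ff x) => t evf ht; case: (Fg x) => t' evg ht'.
exists ((1 + t).+1 + (1 + t').+1).+1; last by rewrite /=; lia.
exact: (EvalCons (EvalCall (EvalVar _ [:: x] 0) evf) (EvalCall (EvalVar _ [:: x] 0) evg)).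
Qed.

Lemma tree_size_hd x : tree_size (tree_hd x) <= tree_size x.
Proof. by case: x => //= x y; lia. Qed.

Lemma tree_size_tl x : tree_size (tree_tl x) <= tree_size x.
Proof. by case: x => //= x y; lia. Qed.

Lemma ptime_hd f : ptime f -> ptime (fun x => tree_hd (f x)).
Proof.
move=> pf; apply: (ptime_comp pf (g := tree_hd)).
exists [:: EHd (EVar 0)], 0, (fun x => 2 + tree_size x); split.
  exact: pboundD (pbound_const _) pbound_size.
move=> x; exists 2; first exact: (EvalHd (EvalVar _ [:: x] 0)).
by rewrite leq_add2l tree_size_hd.
Qed.

Lemma ptime_tl f : ptime f -> ptime (fun x => tree_tl (f x)).
Proof.
move=> pf; apply: (ptime_comp pf (g := tree_tl)).
exists [:: ETl (EVar 0)], 0, (fun x => 2 + tree_size x); split.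
  exact: pboundD (pbound_const _) pbound_size.
move=> x; exists 2; first exact: (EvalTl (EvalVar _ [:: x] 0)).
by rewrite leq_add2l tree_size_tl.
Qed.

Definition is_node (x : tree) : bool := if x is Node _ _ then true else false.

Lemma is_node_enc_bool b : is_node (enc_bool b) = b.
Proof. by case: b. Qed.

(** Both branches are computed and one result is selected, so only the selector needs a program of
    its own. *)
Lemma ptime_if_node c f g : ptime c -> ptime f -> ptime g ->
  ptime (fun x => if is_node (c x) then f x else g x).
Proof.
move=> pc pf pg; have := ptime_node pc (ptime_node pf pg).
move/(@ptime_comp _ (fun x => if is_node (tree_hd x) then tree_hd (tree_tl x)
                              else tree_tl (tree_tl x))); apply.
pose e := EIf (EHd (EVar 0)) (EHd (ETl (EVar 0))) (ETl (ETl (EVar 0))).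
exists [:: e], 0, (fun x => 6 + tree_size x); split.
  exact: pboundD (pbound_const _) pbound_size.
move=> x; have evx := EvalVar [:: e] [:: x] 0; exists 6.
  have evc := EvalHd evx; case Ex: (tree_hd x) evc => [|y z] evc /=.
    exact: (EvalIfNil _ evc (EvalTl (EvalTl evx))).
  exact: (EvalIfCons _ evc (EvalHd (EvalTl evx))).
rewrite leq_add2l.
by case: (is_node _); apply: leq_trans (tree_size_tl x); [apply: tree_size_hd|apply: tree_size_tl].
Qed.

Definition ptimeb (c : tree -> bool) : Prop := ptime (fun x => enc_bool (c x)).

Lemma ptime_if c f g : ptimeb c -> ptime f -> ptime g ->
  ptime (fun x => if c x then f x else g x).
Proof.
move=> pc pf pg; apply: ptime_ext (ptime_if_node pc pf pg) => x.
by rewrite is_node_enc_bool.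
Qed.

Lemma ptimeb_is_node f : ptime f -> ptimeb (fun x => is_node (f x)).
Proof.
move=> pf; apply: ptime_ext (ptime_if_node pf (ptime_node ptime_leaf ptime_leaf) ptime_leaf) => x.
by case: is_node.
Qed.

Lemma ptimeb_if c f g : ptimeb c -> ptimeb f -> ptimeb g ->
  ptimeb (fun x => if c x then f x else g x).
Proof.
by move=> pc pf pg; apply: ptime_ext (ptime_if pc pf pg) => x; case: (c x).
Qed.

Lemma ptimeb_true : ptimeb (fun=> true).
Proof. exact: ptime_node ptime_leaf ptime_leaf. Qed.

Lemma ptimeb_false : ptimeb (fun=> false).
Proof. exact: ptime_leaf. Qed.

Lemma ptimeb_and b c : ptimeb b -> ptimeb c -> ptimeb (fun x => b x && c x).
Proof. by move=> pb pc; apply: (ptimeb_if pb pc ptimeb_false). Qed.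

Lemma ptimeb_or b c : ptimeb b -> ptimeb c -> ptimeb (fun x => b x || c x).
Proof. by move=> pb pc; apply: (ptimeb_if pb ptimeb_true pc). Qed.

Lemma ptimeb_not b : ptimeb b -> ptimeb (fun x => ~~ b x).
Proof.
move=> pb; apply: ptime_ext (ptimeb_if pb ptimeb_false ptimeb_true) => x.
by case: (b x).
Qed.

(** * Lists of trees and bounded iteration *)

Definition seq_tree (s : seq tree) : tree := foldr Node Leaf s.

Fixpoint tree_seq (x : tree) : seq tree :=
  if x is Node y z then y :: tree_seq z else [::].

Lemma seq_treeK : cancel seq_tree tree_seq.
Proof. by elim=> //= x s ->. Qed.

Lemma tree_seqK : cancel tree_seq seq_tree.
Proof. by elim=> //= x _ y ->. Qed.

Definition ptimes (l : tree -> seq tree) : Prop := ptime (fun x => seq_tree (l x)).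

Lemma ptimes_tree_seq f : ptime f -> ptimes (fun x => tree_seq (f x)).
Proof. by apply: ptime_ext => x; rewrite tree_seqK. Qed.

Lemma size_seq_tree s : size s < tree_size (seq_tree s).
Proof. by elim: s => //= x s IHs; lia. Qed.

Lemma mem_seq_tree s j : tree_size (nth Leaf s j) <= tree_size (seq_tree s).
Proof.
elim: s j => [|x s IHs] [|j] //=; first by lia.
by have := IHs j; lia.
Qed.

Section Fold.

Variables (s : tree -> tree -> tree -> tree) (init : tree -> tree) (l : tree -> seq tree).

(** All recursion goes through this body, which is entry 1 of its table. Its argument is
    [Node (Node x a) r] with the fixed parameter [x], the accumulator [a] and the remaining list
    [r]; entry [i] computes the step. *)
Definition fold_body (i : nat) : expr :=
  EIf (ETl (EVar 0))
    (ECall 1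
       (ECons (ECons (EHd (EHd (EVar 0)))
                 (ECall i (ECons (EHd (EHd (EVar 0)))
                             (ECons (ETl (EHd (EVar 0))) (EHd (ETl (EVar 0)))))))
          (ETl (ETl (EVar 0)))))
    (ETl (EHd (EVar 0))).

Local Notation step := (fun y => s (tree_hd y) (tree_hd (tree_tl y)) (tree_tl (tree_tl y))).

(** A round costs at most [b] for the step, and 30 covers the constant number of other evaluation
    steps. *)
Lemma eval_fold_body F i h b x a r : nth ENil F 1 = fold_body i -> runs F i step h ->
  (forall j, j < size r -> h (Node x (Node (foldl (s x) a (take j r)) (nth Leaf r j))) <= b) ->
  exists2 t, eval F [:: Node (Node x a) (seq_tree r)] (fold_body i) (foldl (s x) a r) t &
    t <= (size r).+1 * (b + 30).
Proof.
move=> F1 Fs; elim: r a => [|c r IHr] a hb.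
  exists (2 + 3).+1; last by rewrite /=; lia.
  have evy := EvalVar F [:: Node (Node x a) Leaf] 0.
  by apply: EvalIfNil; [apply: (EvalTl evy) | apply: (EvalTl (EvalHd evy))].
have [j jr|t ev tb] := IHr (s x a c); first exact: (hb j.+1).
case: (Fs (Node x (Node a c))) => t' /= ev' tb'.
have evy := EvalVar F [:: Node (Node x a) (Node c (seq_tree r))] 0.
eexists.
  apply: EvalIfCons; first exact: (EvalTl evy).
  apply: EvalCall; last by rewrite F1; apply: ev.
  apply: EvalCons; last exact: (EvalTl (EvalTl evy)).
  apply: EvalCons; first exact: (EvalHd (EvalHd evy)).
  apply: EvalCall ev'.
  apply: EvalCons; first exact: (EvalHd (EvalHd evy)).
  apply: EvalCons; first exact: (EvalTl (EvalHd evy)).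
  exact: (EvalHd (EvalTl evy)).
by have /= := hb 0 isT; nia.
Qed.

(** A polynomial step does not suffice, as the accumulator could double in every round; hence the
    bound on all intermediate accumulators. *)
Lemma ptime_foldl : ptime step -> ptime init -> ptimes l ->
  (exists2 B, pbound B &
     forall x j, tree_size (foldl (s x) (init x) (take j (l x))) <= B x) ->
  ptime (fun x => foldl (s x) (init x) (l x)).
Proof.
move=> ps pi pl [B Bb Bs].
have pil : ptime (fun x => Node (Node x (init x)) (seq_tree (l x))).
  exact: ptime_node (ptime_node ptime_id pi) pl.
case: (ptime_merge 2 ps pil) => G [i [j [h [k [[n hn] kb GP]]]]].
pose E := [:: ECall 1 (ECall j (EVar 0)); fold_body i].
have [Fs Fil] := GP E erefl.
(* The sum exceeds the size of any argument passed to the step, with room for its two nodes and the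
   2 added in the base of [pbound]. *)
pose b x := (tree_size x + (B x + (tree_size (seq_tree (l x)) + 5))) ^ n.
have bb : pbound b.
  suff : pbound (fun x => tree_size x + (B x + (tree_size (seq_tree (l x)) + 5))).
    case=> m mP; exists (m * n) => x.
    by rewrite expnM; apply: leq_expl.
  apply: pboundD pbound_size (pboundD Bb (pboundD _ (pbound_const _))).
  exact: ptime_size.
exists (E ++ G), 0, (fun x => 10 + (k x + (tree_size (seq_tree (l x)) * (b x + 30) + B x))).
split.
  apply: pboundD (pbound_const _) (pboundD kb (pboundD (pboundM _ _) Bb)).
    exact: ptime_size.
  exact: pboundD bb (pbound_const _).
move=> x; have [t ev tb] : exists2 t,
    eval (E ++ G) [:: Node (Node x (init x)) (seq_tree (l x))] (fold_body i)
      (foldl (s x) (init x) (l x)) t & t <= (size (l x)).+1 * (b x + 30).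
  apply: (eval_fold_body _ Fs) => // m ml; apply: leq_trans (hn _) _.
  apply: leq_expl => /=.
  by have := Bs x m; have := mem_seq_tree (l x) m; lia.
case: (Fil x) => t' ev' tb'; exists ((1 + t').+1 + t).+1.
  exact: (@EvalCall (E ++ G) [:: x] 1 _ _ _ _ _ (EvalCall (EvalVar _ [:: x] 0) ev') ev).
have := size_seq_tree (l x); have := Bs x (size (l x)); rewrite take_size => h1 h2.
have : t <= tree_size (seq_tree (l x)) * (b x + 30).
  by apply: leq_trans tb _; rewrite leq_mul2r h2 orbT.
by have := tree_size_gt0 (Node (Node x (init x)) (seq_tree (l x))); lia.
Qed.

(** The growth [g] does not depend on the accumulator, so it adds up over the rounds to a
    polynomial. *)
Lemma ptime_foldl_add g : ptime step -> ptime init -> ptimes l -> pbound g ->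
  (forall x a c, tree_size (s x a c) <= tree_size a + g (Node x c)) ->
  ptime (fun x => foldl (s x) (init x) (l x)).
Proof.
move=> ps pi pl [k gk] sg; apply: ptime_foldl => //.
pose K x := (tree_size (Node x (seq_tree (l x)))).+2 ^ k.
exists (fun x => tree_size (init x) + tree_size (seq_tree (l x)) * K x).
  apply: pboundD (ptime_size pi) (pboundM (ptime_size pl) _).
  apply: (@pbound_comp (fun y => (tree_size y).+2 ^ k)); first by exists k.
  exact: ptime_size (ptime_node ptime_id pl).
move=> x j; have step_le i a : tree_size (s x a (nth Leaf (l x) i)) <= tree_size a + K x.
  apply: leq_trans (sg _ _ _) _; rewrite leq_add2l; apply: leq_trans (gk _) _.
  apply: leq_expl => /=.
  by have := mem_seq_tree (l x) i; lia.
suff le_j : tree_size (foldl (s x) (init x) (take j (l x))) <=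
    tree_size (init x) + size (take j (l x)) * K x.
  apply: leq_trans le_j _; rewrite leq_add2l leq_mul2r; apply/orP; right.
  by apply: leq_trans (ltnW (size_seq_tree _)); rewrite size_take; case: ltnP => [/ltnW|].
elim: j => [|j IHj]; first by rewrite take0 /=; lia.
case: (ltnP j (size (l x))) => jl; last first.
  by move: IHj; rewrite !take_oversize //; lia.
rewrite (take_nth Leaf) // foldl_rcons size_rcons.
by apply: leq_trans (step_le _ _) _; lia.
Qed.

End Fold.

Lemma ptime2_comp h f g : ptime (fun y => h (tree_hd y) (tree_tl y)) ->
  ptime f -> ptime g -> ptime (fun x => h (f x) (g x)).
Proof. by move=> ph pf pg; apply: (ptime_comp (ptime_node pf pg) ph). Qed.

Lemma ptimeb2_comp P f g : ptimeb (fun y => P (tree_hd y) (tree_tl y)) ->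
  ptime f -> ptime g -> ptimeb (fun x => P (f x) (g x)).
Proof. by move=> pP pf pg; apply: (ptime_comp (ptime_node pf pg) pP). Qed.

Lemma ptime_hd_tl : ptime tree_hd /\ ptime tree_tl.
Proof. by split; [apply: ptime_hd ptime_id | apply: ptime_tl ptime_id]. Qed.

Lemma ptimes_rev l : ptimes l -> ptimes (fun x => rev (l x)).
Proof.
move=> pl.
have : ptime (fun x => foldl (fun a c => Node c a) Leaf (l x)).
  apply: (ptime_foldl_add (s := fun _ a c => Node c a) (init := fun=> Leaf)
    (g := fun y => tree_size y)) => //.
  - by apply: ptime_node; [do 2! apply: ptime_tl|apply/ptime_hd/ptime_tl]; apply: ptime_id.
  - exact: ptime_leaf.
  - exact: pbound_size.
  - by move=> x a c /=; lia.
apply: ptime_ext => x; rewrite -[RHS](_ : foldl (fun a c => Node c a) (seq_tree [::]) (l x) = _) //.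
by rewrite /rev; elim: (l x) [::] => //= c s IHs r; rewrite -IHs.
Qed.

Lemma ptime_foldr_add s init l g :
  ptime (fun y => s (tree_hd y) (tree_hd (tree_tl y)) (tree_tl (tree_tl y))) ->
  ptime init -> ptimes l -> pbound g ->
  (forall x a c, tree_size (s x a c) <= tree_size a + g (Node x c)) ->
  ptime (fun x => foldr (fun c a => s x a c) (init x) (l x)).
Proof.
move=> ps pi pl gb sg; have := ptime_foldl_add ps pi (ptimes_rev pl) gb sg.
by apply: ptime_ext => x; rewrite foldl_rev.
Qed.

Lemma ptimes_cons f l : ptime f -> ptimes l -> ptimes (fun x => f x :: l x).
Proof. exact: ptime_node. Qed.

Lemma ptimes_nil : ptimes (fun=> [::]).
Proof. exact: ptime_leaf. Qed.

Lemma ptimes_cat l1 l2 : ptimes l1 -> ptimes l2 -> ptimes (fun x => l1 x ++ l2 x).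
Proof.
move=> p1 p2; have : ptime (fun x => foldr (fun c a => Node c a) (seq_tree (l2 x)) (l1 x)).
  apply: (ptime_foldr_add (s := fun _ a c => Node c a) (g := fun y => tree_size y)) => //.
  - by apply: ptime_node; [do 2! apply: ptime_tl|apply/ptime_hd/ptime_tl]; apply: ptime_id.
  - exact: pbound_size.
  - by move=> x a c /=; lia.
by apply: ptime_ext => x; rewrite /seq_tree foldr_cat.
Qed.

Lemma ptimes_map f l : ptime (fun y => f (tree_hd y) (tree_tl y)) -> ptimes l ->
  ptimes (fun x => map (f x) (l x)).
Proof.
move=> pf pl; have : ptime (fun x => foldr (fun c a => Node (f x c) a) Leaf (l x)).
  apply: (ptime_foldr_add (s := fun x a c => Node (f x c) a) (init := fun=> Leaf)
    (g := fun y => 1 + tree_size (f (tree_hd y) (tree_tl y)))) => //.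
  - apply: ptime_node; last by apply/ptime_hd/ptime_tl/ptime_id.
    apply: (ptime2_comp pf); first by apply/ptime_hd/ptime_id.
    by do 2! apply: ptime_tl; apply: ptime_id.
  - exact: ptime_leaf.
  - exact: pboundD (pbound_const 1) (ptime_size pf).
  - by move=> x a c /=; lia.
by apply: ptime_ext => x; rewrite /seq_tree foldr_map.
Qed.

Lemma ptimes_filter P l : ptimeb (fun y => P (tree_hd y) (tree_tl y)) -> ptimes l ->
  ptimes (fun x => filter (P x) (l x)).
Proof.
move=> pP pl; have : ptime (fun x => foldr (fun c a => if P x c then Node c a else a) Leaf (l x)).
  apply: (ptime_foldr_add (s := fun x a c => if P x c then Node c a else a)
    (init := fun=> Leaf) (g := fun y => tree_size y)) => //.
  - apply: ptime_if; last by apply/ptime_hd/ptime_tl/ptime_id.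
      apply: (ptimeb2_comp pP); first by apply/ptime_hd/ptime_id.
      by do 2! apply: ptime_tl; apply: ptime_id.
    by apply: ptime_node; [do 2! apply: ptime_tl|apply/ptime_hd/ptime_tl]; apply: ptime_id.
  - exact: ptime_leaf.
  - exact: pbound_size.
  - by move=> x a c; case: ifP => /= _; lia.
by apply: ptime_ext => x; elim: (l x) => //= c s ->; case: ifP.
Qed.

Lemma ptimeb_has P l : ptimeb (fun y => P (tree_hd y) (tree_tl y)) -> ptimes l ->
  ptimeb (fun x => has (P x) (l x)).
Proof.
move=> pP pl; have : ptime (fun x => foldr (fun c a => enc_bool (P x c || is_node a)) Leaf (l x)).
  apply: (ptime_foldr_add (s := fun x a c => enc_bool (P x c || is_node a))
    (init := fun=> Leaf) (g := fun=> 3)) => //.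
  - apply: ptimeb_or; last by apply/ptimeb_is_node/ptime_hd/ptime_tl/ptime_id.
    apply: (ptimeb2_comp pP); first by apply/ptime_hd/ptime_id.
    by do 2! apply: ptime_tl; apply: ptime_id.
  - exact: ptime_leaf.
  - exact: pbound_const.
  - by move=> x a c; case: (_ || _) => /=; lia.
by apply: ptime_ext => x; elim: (l x) => //= c s ->; rewrite is_node_enc_bool.
Qed.

Lemma ptimeb_all P l : ptimeb (fun y => P (tree_hd y) (tree_tl y)) -> ptimes l ->
  ptimeb (fun x => all (P x) (l x)).
Proof.
move=> pP pl; have := ptimeb_not (ptimeb_has (P := fun x c => ~~ P x c) (ptimeb_not pP) pl).
by apply: ptime_ext => x; rewrite (has_predC (P x)) negbK.
Qed.

(** Only the length of the list matters: it is a unary clock. *)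
Lemma ptime_iter f init l g : ptime (fun y => f (tree_hd y) (tree_tl y)) ->
  ptime init -> ptimes l -> pbound g ->
  (forall x a, tree_size (f x a) <= tree_size a + g x) ->
  ptime (fun x => iter (size (l x)) (f x) (init x)).
Proof.
move=> pf pi pl gb fg; have : ptime (fun x => foldl (fun a _ => f x a) (init x) (l x)).
  apply: (ptime_foldl_add (s := fun x a _ => f x a) (g := fun y => g (tree_hd y))) => //.
  - by apply: (ptime2_comp pf); [|apply: ptime_hd]; case: ptime_hd_tl.
  - by apply: pbound_comp gb _; apply: ptime_size; case: ptime_hd_tl.
apply: ptime_ext => x; elim: (l x) (init x) => //= _ s IHs a.
by rewrite IHs -iterSr.
Qed.

Lemma ptimes_mask f l : ptime f -> ptimes l ->
  ptimes (fun x => mask (map is_node (tree_seq (f x))) (l x)).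
Proof.
move=> pf pl.
(* The accumulator holds the unread mask and the reversed output. An exhausted mask reads as [Leaf],
   that is false, in agreement with [mask]. *)
pose s a c := Node (tree_tl (tree_hd a))
  (if is_node (tree_hd (tree_hd a)) then Node c (tree_tl a) else tree_tl a).
have sE r : forall m (out : seq tree), tree_tl (foldl s (Node m (seq_tree out)) r) =
    seq_tree (catrev (mask (map is_node (tree_seq m)) r) out).
  elim: r => [|c r IHr] m out; first by rewrite mask0.
  case: m => [|b m] /=; first by rewrite (IHr Leaf) mask0s.
  by rewrite /s /=; case: (is_node b); rewrite /= -IHr.
have : ptimes (fun x => rev (tree_seq (tree_tl (foldl s (Node (f x) Leaf) (l x))))).
  apply/ptimes_rev/ptimes_tree_seq/ptime_tl.
  apply: (ptime_foldl_add (s := fun=> s) (init := fun x => Node (f x) Leaf)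
    (g := fun y => tree_size y)) => //.
  - have pa : ptime (fun y => tree_hd (tree_tl y)) by apply/ptime_hd/ptime_tl/ptime_id.
    apply: ptime_node; first exact/ptime_tl/ptime_hd.
    apply: ptime_if; [exact/ptimeb_is_node/ptime_hd/ptime_hd| |exact: ptime_tl].
    by apply: ptime_node; [apply/ptime_tl/ptime_tl/ptime_id|apply: ptime_tl].
  - exact: ptime_node pf ptime_leaf.
  - exact: pbound_size.
  - move=> x a c; have := tree_size_gt0 x; rewrite /s; case: a => [|a1 a2] /=; first by lia.
    by have := tree_size_tl a1; case: ifP => /= _; lia.
by apply: ptime_ext => x; rewrite (sE _ _ [::]) seq_treeK revK.
Qed.

(** * Arithmetic on binary numerals *)

(* Binary numbers with the least significant bit first; Leaf pads with zeros, so
   any list that is long enough can clock the digitwise loops. *)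
Fixpoint bval (x : tree) : nat :=
  if x is Node b y then is_node b + 2 * bval y else 0.

Lemma bvalE x : bval x = is_node (tree_hd x) + 2 * bval (tree_tl x).
Proof. by case: x. Qed.

Lemma bval_lt x : bval x < 2 ^ size (tree_seq x).
Proof. by elim: x => //= b _ x IHx; rewrite expnS; case: is_node => /=; lia. Qed.

Lemma tree_size_enc_bool b : tree_size (enc_bool b) <= 3.
Proof. by case: b. Qed.

(** Digits are read from the least significant one, so a later difference overrides the verdict so
    far and equal digits keep it. *)
Definition ble_step (a : tree) : tree :=
  let x := tree_hd (tree_tl a) in let y := tree_tl (tree_tl a) in
  Node (enc_bool (if is_node (tree_hd x) then is_node (tree_hd y) && is_node (tree_hd a)
                  else is_node (tree_hd y) || is_node (tree_hd a)))
    (Node (tree_tl x) (tree_tl y)).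

Definition ble (x y : tree) : bool :=
  is_node (tree_hd (foldl (fun a _ => ble_step a) (Node (enc_bool true) (Node x y))
                      (tree_seq x ++ tree_seq y))).

Lemma bleE x y : ble x y = (bval x <= bval y).
Proof.
have gen (r : seq tree) : forall b u v,
    bval u < 2 ^ size r -> bval v < 2 ^ size r ->
    is_node (tree_hd (foldl (fun a _ => ble_step a) (Node (enc_bool b) (Node u v)) r)) =
    (bval u < bval v) || (bval u == bval v) && b.
  elim: r => [|_ r IHr] b u v /=; rewrite ?expnS.
    by rewrite is_node_enc_bool; case: (bval u) (bval v) => [|?] [|?].
  rewrite (bvalE u) (bvalE v) /ble_step /= => hu hv.
  rewrite IHr ?is_node_enc_bool; [|by lia|by lia].
  by case: (is_node (tree_hd u)); case: (is_node (tree_hd v)); case: b => /=; lia.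
rewrite /ble gen ?size_cat; first by rewrite andbT orbC -leq_eqVlt.
  by apply: leq_trans (bval_lt x) _; rewrite leq_exp2l // leq_addr.
by apply: leq_trans (bval_lt y) _; rewrite leq_exp2l // leq_addl.
Qed.

Lemma ptimeb_ble f g : ptime f -> ptime g -> ptimeb (fun x => ble (f x) (g x)).
Proof.
move=> pf pg; apply/ptimeb_is_node/ptime_hd.
apply: (ptime_foldl_add (s := fun _ a _ => ble_step a)
  (init := fun x => Node (enc_bool true) (Node (f x) (g x))) (g := fun=> 9)).
- have pa : ptime (fun y => tree_hd (tree_tl y)) by apply/ptime_hd/ptime_tl/ptime_id.
  have px := ptime_hd (ptime_tl pa); have py := ptime_tl (ptime_tl pa).
  apply: ptime_node; last exact: ptime_node (ptime_tl px) (ptime_tl py).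
  apply: ptimeb_if; [|apply: ptimeb_and|apply: ptimeb_or]; apply/ptimeb_is_node; exact: ptime_hd.
- exact: ptime_node ptimeb_true (ptime_node pf pg).
- by apply: ptimes_cat; apply: ptimes_tree_seq.
- exact: pbound_const.
- move=> _ a _; rewrite /ble_step; set b := (X in enc_bool X).
  move: (tree_size_enc_bool b); move: (enc_bool b) => u {b}.
  case: a => [|a1 [|x y]] /=; try by lia.
  by have := tree_size_tl x; have := tree_size_tl y; lia.
Qed.

Definition beq (x y : tree) : bool := ble x y && ble y x.

Lemma beqE x y : beq x y = (bval x == bval y).
Proof. by rewrite /beq !bleE -eqn_leq. Qed.

Lemma ptimeb_beq f g : ptime f -> ptime g -> ptimeb (fun x => beq (f x) (g x)).
Proof. by move=> pf pg; apply: ptimeb_and; apply: ptimeb_ble. Qed.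

Definition carry (b c d : bool) : bool := if b then c || d else c && d.
Definition sumbit (b c d : bool) : bool := if b then (if c then d else ~~ d) else (if c then ~~ d else d).

Fixpoint addc (r : seq tree) (d : bool) (x y : tree) : tree :=
  if r is _ :: r' then
    let b := is_node (tree_hd x) in let c := is_node (tree_hd y) in
    Node (enc_bool (sumbit b c d)) (addc r' (carry b c d) (tree_tl x) (tree_tl y))
  else Leaf.

Lemma bval_addc r (d : bool) x y : d + bval x + bval y < 2 ^ size r ->
  bval (addc r d x y) = d + bval x + bval y.
Proof.
elim: r d x y => [|_ r IHr] d x y /=.
  by case: d (bval x) (bval y) => [] [|?] [|?].
rewrite (bvalE x) (bvalE y) expnS is_node_enc_bool => h.
rewrite IHr; move: h;
  by case: (is_node (tree_hd x)); case: (is_node (tree_hd y)); case: d => /=; lia.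
Qed.

(** One digit more than both lengths together leaves room for the final carry. *)
Definition bclock (x y : tree) : seq tree := Leaf :: tree_seq x ++ tree_seq y.

Definition badd (x y : tree) : tree := addc (bclock x y) false x y.

Lemma bval_add x y : bval (badd x y) = bval x + bval y.
Proof.
rewrite bval_addc // /bclock /= size_cat expnS expnD.
by have := bval_lt x; have := bval_lt y; nia.
Qed.

(** [addc] as a loop whose state consists of the carry, the reversed output and the unread
    digits. *)
Definition add_step (a : tree) : tree :=
  let d := is_node (tree_hd a) in let out := tree_hd (tree_tl a) in
  let x := tree_hd (tree_tl (tree_tl a)) in let y := tree_tl (tree_tl (tree_tl a)) in
  let b := is_node (tree_hd x) in let c := is_node (tree_hd y) in
  Node (enc_bool (carry b c d))
    (Node (Node (enc_bool (sumbit b c d)) out) (Node (tree_tl x) (tree_tl y))).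

Lemma ptime_badd f g : ptime f -> ptime g -> ptime (fun x => badd (f x) (g x)).
Proof.
move=> pf pg.
have stepE r : forall d out x y,
    tree_hd (tree_tl (foldl (fun a _ => add_step a)
      (Node (enc_bool d) (Node (seq_tree out) (Node x y))) r)) =
    seq_tree (catrev (tree_seq (addc r d x y)) out).
  elim: r => [|_ r IHr] d out x y //=.
  by rewrite /add_step /= is_node_enc_bool -IHr.
have : ptimes (fun x => rev (tree_seq (tree_hd (tree_tl (foldl (fun a _ => add_step a)
      (Node (enc_bool false) (Node Leaf (Node (f x) (g x)))) (bclock (f x) (g x))))))).
  apply/ptimes_rev/ptimes_tree_seq/ptime_hd/ptime_tl.
  apply: (ptime_foldl_add (s := fun _ a _ => add_step a)
    (init := fun x => Node (enc_bool false) (Node Leaf (Node (f x) (g x))))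
    (g := fun=> 16)).
  - have pa : ptime (fun y => tree_hd (tree_tl y)) by apply/ptime_hd/ptime_tl/ptime_id.
    have pr := ptime_tl pa.
    have px := ptime_hd (ptime_tl pr); have py := ptime_tl (ptime_tl pr).
    have pb := ptimeb_is_node (ptime_hd px); have pc := ptimeb_is_node (ptime_hd py).
    have pd := ptimeb_is_node (ptime_hd pa).
    apply: ptime_node; first by apply: ptimeb_if pb (ptimeb_or _ _) (ptimeb_and _ _).
    apply: ptime_node; last exact: ptime_node (ptime_tl px) (ptime_tl py).
    apply: ptime_node; last exact: ptime_hd.
    have pnd := ptimeb_not pd.
    exact: ptimeb_if pb (ptimeb_if pc pd pnd) (ptimeb_if pc pnd pd).
  - exact: ptime_node ptimeb_false (ptime_node ptime_leaf (ptime_node pf pg)).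
  - exact: ptimes_cons ptime_leaf (ptimes_cat (ptimes_tree_seq pf) (ptimes_tree_seq pg)).
  - exact: pbound_const.
  - move=> _ a _; rewrite /add_step /=.
    set b := carry _ _ _; set c := sumbit _ _ _.
    move: (tree_size_enc_bool b) (tree_size_enc_bool c).
    move: (enc_bool b) (enc_bool c) => u v {b c}.
    case: a => [|a1 [|a2 [|x y]]] /=; try by lia.
    by have := tree_size_tl x; have := tree_size_tl y; lia.
apply: ptime_ext => x; rewrite (stepE _ false [::]) seq_treeK revK tree_seqK //.
Qed.

Lemma size_addc r d x y : size (tree_seq (addc r d x y)) = size r /\
  tree_size (addc r d x y) <= (4 * size r).+1.
Proof.
elim: r d x y => //= _ r IHr d x y; case: (IHr (carry (is_node (tree_hd x))
  (is_node (tree_hd y)) d) (tree_tl x) (tree_tl y)) => -> h; split=> //.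
by case: (sumbit _ _ _) => /=; lia.
Qed.

Lemma size_badd x y :
  size (tree_seq (badd x y)) = (size (tree_seq x) + size (tree_seq y)).+1 /\
  tree_size (badd x y) <= (4 * (size (tree_seq x) + size (tree_seq y)).+1).+1.
Proof. by have := size_addc (bclock x y) false x y; rewrite /= size_cat. Qed.

(** Horner's rule: [Node Leaf acc] doubles [acc]. *)
Definition mul_step (y acc b : tree) : tree :=
  if is_node b then badd (Node Leaf acc) y else Node Leaf acc.

Definition bmul (x y : tree) : tree := foldr (fun b acc => mul_step y acc b) Leaf (tree_seq x).

Lemma bval_mul x y : bval (bmul x y) = bval x * bval y.
Proof.
rewrite /bmul; elim: x => //= b _ x IHx.
by rewrite /mul_step; case: (is_node b); rewrite ?bval_add /= IHx; lia.
Qed.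

(** [size_badd] bounds the sum by digit counts and not by an increment of tree size. So the digits
    of the accumulator are counted: each round adds at most [tree_size (g x) + 2] of them, and each
    takes up at most 4. *)
Lemma ptime_bmul f g : ptime f -> ptime g -> ptime (fun x => bmul (f x) (g x)).
Proof.
move=> pf pg.
have : ptime (fun x => foldl (mul_step (g x)) Leaf (rev (tree_seq (f x)))).
  apply: (ptime_foldl (s := fun x => mul_step (g x)) (init := fun=> Leaf)).
  - have pa : ptime (fun y => tree_hd (tree_tl y)) by apply/ptime_hd/ptime_tl/ptime_id.
    have pn := ptime_node ptime_leaf pa.
    apply: ptime_if => //; first exact/ptimeb_is_node/ptime_tl/ptime_tl/ptime_id.
    exact/(ptime_badd pn)/(ptime_comp _ pg)/ptime_hd/ptime_id.
  - exact: ptime_leaf.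
  - exact/ptimes_rev/ptimes_tree_seq.
  exists (fun x => (4 * (tree_size (f x) * (tree_size (g x) + 2))) + 1).
    apply: pboundD (pbound_const _); apply: pboundM (pbound_const _) (pboundM (ptime_size pf) _).
    exact: pboundD (ptime_size pg) (pbound_const _).
  move=> x j; have gen (r : seq tree) : let a := foldl (mul_step (g x)) Leaf r in
      size (tree_seq a) <= size r * (tree_size (g x) + 2) /\
      tree_size a <= (4 * size (tree_seq a)).+1.
    elim/last_ind: r => //= r b; rewrite foldl_rcons size_rcons.
    move: (foldl _ _ _) => a [IH1 IH2]; rewrite /mul_step; case: (is_node b); last by move=> /=; lia.
    have [-> szT] := size_badd (Node Leaf a) (g x); split=> //; move: IH1 => /=.
    by have := size_seq_tree (tree_seq (g x)); rewrite tree_seqK; nia.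
  set r := take _ _; have [h1 h2] := gen r; apply: leq_trans h2 _.
  have hr : size r <= tree_size (f x).
    rewrite /r size_take size_rev; have := size_seq_tree (tree_seq (f x)); rewrite tree_seqK.
    by move=> /ltnW ?; case: ltnP => // /ltnW/leq_trans; apply.
  by rewrite -addn1 leq_add2r leq_mul2l; apply: leq_trans h1 _; rewrite leq_mul2r hr orbT.
by apply: ptime_ext => x; rewrite foldl_rev.
Qed.

(** * Graph search by saturation *)

Section Saturation.

Variables (T : Type) (rel : T -> T -> bool).

(** Elements already present may be added again. This avoids an equality test, and a round still
    adds no more than [U]. *)
Definition saturate_step (U S : seq T) : seq T :=
  [seq f <- U | has (rel^~ f) S] ++ S.

Definition saturate (U S : seq T) : seq T := iter (size U) (saturate_step U) S.

End Saturation.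

Lemma tree_size_cat r s : tree_size (seq_tree (r ++ s)) <=
  tree_size (seq_tree r) + tree_size (seq_tree s).
Proof. by elim: r => //= x r IHr; lia. Qed.

Lemma tree_size_filter P r : tree_size (seq_tree (filter P r)) <= tree_size (seq_tree r).
Proof. by elim: r => //= x r IHr; case: ifP => /= _; lia. Qed.

Lemma ptimes_saturate rel U S :
  ptimeb (fun y => rel (tree_hd y) (tree_hd (tree_tl y)) (tree_tl (tree_tl y))) ->
  ptimes U -> ptimes S -> ptimes (fun x => saturate (rel x) (U x) (S x)).
Proof.
move=> pr pU pS.
have : ptime (fun x => iter (size (U x))
    (fun a => seq_tree (saturate_step (rel x) (U x) (tree_seq a))) (seq_tree (S x))).
  apply: (ptime_iter (f := fun x a => seq_tree (saturate_step (rel x) (U x) (tree_seq a)))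
    (g := fun x => tree_size (seq_tree (U x)))) => //.
  - have [ph pt] := ptime_hd_tl.
    apply: ptimes_cat; last exact: ptimes_tree_seq pt.
    apply: ptimes_filter; last exact: ptime_comp ph pU.
    apply: ptimeb_has; last by apply/ptimes_tree_seq/ptime_tl.
    apply: (ptime_comp (f := fun y => Node (tree_hd (tree_hd (tree_hd y)))
      (Node (tree_tl y) (tree_tl (tree_hd y)))) _ pr).
    by apply: ptime_node; [do 2!apply: ptime_hd|apply/(ptime_node pt)/ptime_tl].
  - exact: ptime_size.
  - move=> x a; rewrite addnC; apply: leq_trans (tree_size_cat _ _) _.
    by rewrite tree_seqK leq_add2r tree_size_filter.
apply: ptime_ext => x; rewrite /saturate; move: (size (U x)) => n.
by elim: n => //= n ->; rewrite seq_treeK.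
Qed.

(** * The decision procedure *)

Lemma saturate_map (T T' : Type) (h : T -> T') rel U S :
  saturate rel (map h U) (map h S) = map h (saturate (fun e f => rel (h e) (h f)) U S).
Proof.
rewrite /saturate size_map; elim: (size U) => //= n ->.
rewrite /saturate_step filter_map map_cat; congr (map _ _ ++ _).
by apply: eq_filter => f /=; rewrite has_map.
Qed.

Lemma eq_saturate (T : Type) (rel rel' : T -> T -> bool) U S :
  rel =2 rel' -> saturate rel U S = saturate rel' U S.
Proof.
move=> relE; rewrite /saturate; elim: (size U) => //= n ->.
rewrite /saturate_step; congr (_ ++ _); apply: eq_filter => f.
by apply: eq_has => e; rewrite relE.
Qed.

Lemma mem_saturate (T : finType) (r : rel T) U S f :
  (forall x y, r x y -> y \in U) -> #|T| <= size U ->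
  (f \in saturate r U S) = has (fun e => connect r e f) S.
Proof.
move=> rU leU; apply/idP/hasP => [|[e eS /connectP[p pP ->]]].
  rewrite /saturate; elim: (size U) f => [|n IHn] f /=; first by exists f.
  rewrite mem_cat mem_filter => /orP[/andP[/hasP[e /IHn[g gS ge] ef] _]|/IHn//].
  by exists g => //; apply: connect_trans ge (connect1 ef).
case/shortenP: pP => q qP qu _.
have : size q <= size U.
  by apply: leq_trans leU; apply: ltnW; have := card_uniqP qu => /= <-; apply: max_card.
rewrite /saturate; elim: (size U) e q qP S eS {f p qu leU} => [|n IHn] e [|f q] //=.
  by move=> _ S eS _; elim: n {IHn} => [|n IHn] /=; rewrite mem_cat ?eS ?IHn orbT.
(* The first round is split off: it adds [f], from which the rest of the path is followed. *)
case/andP=> ef qP S eS szq; rewrite -iterS iterSr; apply: IHn => //.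
rewrite mem_cat mem_filter (rU _ _ ef) andbT; apply/orP; left.
by apply/hasP; exists e.
Qed.

Definition t_tail (e : tree) : tree := tree_hd e.
Definition t_head (e : tree) : tree := tree_hd (tree_tl e).

(** Fractions are compared by cross-multiplication. *)
Definition t_label_le (a b : tree) : bool :=
  ble (bmul (tree_hd a) (tree_tl b)) (bmul (tree_hd b) (tree_tl a)).

Definition t_prec (e f : tree) : bool :=
  beq (t_head e) (t_tail f) && t_label_le (tree_tl (tree_tl e)) (tree_tl (tree_tl f)).

Definition t_arcs (x : tree) : seq tree := tree_seq (tree_hd (tree_tl x)).

(* On valid instances with an arc every vertex is an end of an arc, so the number
   of vertices, which is given in binary, need not be read. *)
Definition t_ends (x : tree) : seq tree :=
  map t_tail (t_arcs x) ++ map t_head (t_arcs x).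

Definition t_covers (S : seq tree) (v : tree) : bool := has (fun f => beq (t_head f) v) S.

Definition t_full (x e : tree) : bool :=
  all (t_covers (saturate t_prec (t_arcs x) [:: e])) (t_ends x).

Definition t_root_rel (x u v : tree) : bool :=
  has (fun e => t_full x e &&
    (beq (t_tail e) u && beq (t_head e) v || beq (t_tail e) v && beq (t_head e) u)) (t_arcs x).

Definition t_select (x c : tree) : seq tree := mask (map is_node (tree_seq c)) (t_arcs x).

Definition t_source (x : tree) : seq tree := t_select x (tree_hd (tree_tl (tree_tl x))).
Definition t_target (x : tree) : seq tree := t_select x (tree_tl (tree_tl (tree_tl x))).

(* The root of an arborescence is the vertex that it does not cover. *)
Definition t_decide (x : tree) : bool :=
  all (fun v => t_covers (t_target x) v ||
    has (fun u => beq u v)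
      (saturate (t_root_rel x) (t_ends x) [seq v <- t_ends x | ~~ t_covers (t_source x) v]))
    (t_ends x).

Lemma ptime_t_tail f : ptime f -> ptime (fun x => t_tail (f x)).
Proof. exact: ptime_hd. Qed.

Lemma ptime_t_head f : ptime f -> ptime (fun x => t_head (f x)).
Proof. by move=> pf; apply/ptime_hd/ptime_tl. Qed.

Lemma ptimeb_t_prec f g : ptime f -> ptime g -> ptimeb (fun x => t_prec (f x) (g x)).
Proof.
move=> pf pg; have lf := ptime_tl (ptime_tl pf); have lg := ptime_tl (ptime_tl pg).
apply: ptimeb_and; first exact: ptimeb_beq (ptime_t_head pf) (ptime_t_tail pg).
apply: ptimeb_ble; apply: ptime_bmul; by [apply: ptime_hd | apply: ptime_tl].
Qed.

Lemma ptimes_t_arcs f : ptime f -> ptimes (fun x => t_arcs (f x)).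
Proof. by move=> pf; apply/ptimes_tree_seq/ptime_hd/ptime_tl. Qed.

Lemma ptimes_t_ends f : ptime f -> ptimes (fun x => t_ends (f x)).
Proof.
move=> pf; have [_ pt] := ptime_hd_tl.
apply: ptimes_cat; apply: (@ptimes_map (fun=> _)); try exact: ptimes_t_arcs.
  exact: ptime_t_tail.
exact: ptime_t_head.
Qed.

Lemma ptimeb_t_covers S f : ptimes S -> ptime f -> ptimeb (fun x => t_covers (S x) (f x)).
Proof.
move=> pS pf; have [ph pt] := ptime_hd_tl.
by apply: ptimeb_has pS; apply: ptimeb_beq (ptime_t_head pt) (ptime_comp ph pf).
Qed.

Lemma ptimeb_t_full f g : ptime f -> ptime g -> ptimeb (fun x => t_full (f x) (g x)).
Proof.
move=> pf pg; have [ph pt] := ptime_hd_tl.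
apply: ptimeb_all; last exact: ptimes_t_ends.
apply: (ptimeb_t_covers _ pt); apply: (@ptimes_saturate (fun=> t_prec)).
- exact: ptimeb_t_prec (ptime_hd pt) (ptime_tl pt).
- exact/ptimes_t_arcs/(ptime_comp ph).
- exact: ptimes_cons (ptime_comp ph pg) ptimes_nil.
Qed.

Lemma ptimeb_t_root_rel f g h : ptime f -> ptime g -> ptime h ->
  ptimeb (fun x => t_root_rel (f x) (g x) (h x)).
Proof.
move=> pf pg phh; have [ph pt] := ptime_hd_tl.
apply: ptimeb_has; last exact: ptimes_t_arcs.
have [pf' pg' ph'] := And3 (ptime_comp ph pf) (ptime_comp ph pg) (ptime_comp ph phh).
apply: ptimeb_and; first exact: ptimeb_t_full.
have [pe pe'] := conj (ptime_t_tail pt) (ptime_t_head pt).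
by apply: ptimeb_or; apply: ptimeb_and; apply: ptimeb_beq.
Qed.

Lemma ptimeb_t_decide : ptimeb t_decide.
Proof.
have [ph pt] := ptime_hd_tl.
have p3 f : ptime f -> ptime (fun x => tree_tl (tree_tl (f x))).
  by move=> pf; do 2!apply: ptime_tl.
have psel f g : ptime f -> ptime g -> ptimes (fun x => t_select (f x) (g x)).
  by move=> pf pg; apply: ptimes_mask (ptimes_t_arcs pf).
apply: ptimeb_all; last exact: ptimes_t_ends ptime_id.
apply: ptimeb_or.
  by apply: ptimeb_t_covers pt; apply: psel ph (ptime_tl (p3 _ ph)).
apply: (@ptimeb_has (fun y u => beq u (tree_tl y))); first exact: ptimeb_beq pt (ptime_tl ph).
apply: (@ptimes_saturate (fun y => t_root_rel (tree_hd y))).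
- exact: ptimeb_t_root_rel (ptime_hd ph) (ptime_hd pt) (ptime_tl pt).
- exact: ptimes_t_ends.
- apply: ptimes_filter (ptimes_t_ends ph); apply: ptimeb_not.
  by apply: ptimeb_t_covers pt; apply: psel (ptime_hd ph) (ptime_hd (p3 _ (ptime_hd ph))).
Qed.

(** * Correctness of the procedure on encoded instances *)

Lemma bval_enc_nat n : bval (enc_nat n) = n.
Proof.
rewrite /enc_nat /bits -{2}(bin_of_natK n); case: (bin_of_nat n) => //=.
elim=> [p IHp|p IHp|] //=; rewrite IHp NatTrec.doubleE; lia.
Qed.

Lemma beq_enc_nat m n : beq (enc_nat m) (enc_nat n) = (m == n).
Proof. by rewrite beqE !bval_enc_nat. Qed.

Lemma t_label_le_enc a b : (0 <= a)%R -> (0 <= b)%R ->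
  t_label_le (enc_label a) (enc_label b) = (a <= b)%R.
Proof.
move=> a0 b0; rewrite -[RHS](_ : le_rat a b = _) // le_ratE /t_label_le bleE !bval_mul /=.
rewrite !bval_enc_nat -lez_nat !PoszM !absz_denq !gez0_abs ?numq_ge0 //.
Qed.

Lemma enc_seqE (X : Type) (enc : X -> tree) s : enc_seq enc s = seq_tree (map enc s).
Proof. by rewrite /seq_tree foldr_map. Qed.

Section Instance.

Variable I : tar_instance.
Hypothesis label_ge0 : forall e, (0 <= @label I e)%R.
Local Notation V := 'I_(nv (graph I)).
Local Notation A := 'I_(na (graph I)).
Local Notation x := (enc_instance I).
Local Notation enc_e := (@enc_arc I).
Local Notation enc_v := (fun v : V => enc_nat v).
Local Notation tl := (@arc_tail (graph I)).
Local Notation hd := (@arc_head (graph I)).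

Definition ends : seq V := map tl (enum A) ++ map hd (enum A).

Lemma mem_tl e : tl e \in ends.
Proof. by rewrite mem_cat map_f ?mem_enum. Qed.

Lemma mem_hd e : hd e \in ends.
Proof. by rewrite mem_cat orbC map_f ?mem_enum. Qed.

Lemma beq_enc (u v : V) : beq (enc_nat u) (enc_nat v) = (u == v).
Proof. by rewrite beq_enc_nat. Qed.

Lemma t_arcs_enc : t_arcs x = map enc_e (enum A).
Proof. by rewrite /t_arcs /= enc_seqE seq_treeK. Qed.

Lemma t_ends_enc : t_ends x = map enc_v ends.
Proof. by rewrite /t_ends t_arcs_enc map_cat -!map_comp. Qed.

Lemma t_prec_enc e f : t_prec (enc_e e) (enc_e f) = prec (@label I) e f.
Proof. by rewrite /t_prec beq_enc t_label_le_enc. Qed.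

Lemma t_covers_enc (S : seq A) v :
  t_covers (map enc_e S) (enc_v v) = has (fun f => hd f == v) S.
Proof. by rewrite /t_covers has_map; apply: eq_has => f /=; rewrite beq_enc. Qed.

Lemma t_select_enc (T : {set A}) : t_select x (enc_arcs T) = map enc_e [seq e <- enum A | e \in T].
Proof.
rewrite /t_select /enc_arcs enc_seqE seq_treeK t_arcs_enc -map_mask filter_mask -map_comp.
by congr (map _ (mask _ _)); apply: eq_map => e /=; rewrite is_node_enc_bool.
Qed.

Hypothesis ends_all : 0 < na (graph I) -> forall v, v \in ends.

Lemma t_full_enc e : t_full x (enc_e e) = full (@label I) e.
Proof.
rewrite /t_full t_arcs_enc t_ends_enc (saturate_map enc_e _ _ [:: e]) all_map.
have vE (v : V) : t_covers (map enc_e (saturate (fun e f => t_prec (enc_e e) (enc_e f)) (enum A) [:: e]))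
   (enc_v v) = [exists f, connect (prec (@label I)) e f && (hd f == v)].
  rewrite t_covers_enc (eq_saturate _ _ t_prec_enc); apply/hasP/existsP => [[f]|[f /andP[ef fv]]].
    rewrite mem_saturate ?cardE //; last by move=> ? ? _; rewrite mem_enum.
    by rewrite /= orbF => ef fv; exists f; rewrite ef.
  exists f => //; rewrite mem_saturate ?cardE //= ?ef //.
  by move=> ? ? _; rewrite mem_enum.
apply/allP/forallP => [h v|h v _]; last by rewrite /= vE; apply: h.
rewrite -vE; apply: h; apply: ends_all; exact: leq_ltn_trans (ltn_ord e).
Qed.

Lemma t_root_rel_enc u v : t_root_rel x (enc_v u) (enc_v v) = root_rel (@label I) u v.
Proof.
rewrite /t_root_rel t_arcs_enc has_map; apply/hasP/existsP => -[e].
  by rewrite /= t_full_enc !beq_enc => _ he; exists e.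
by move=> he; exists e; rewrite ?mem_enum //= t_full_enc !beq_enc.
Qed.

Lemma tra_covered r T v : tra (@label I) r T ->
  has (fun f => hd f == v) [seq e <- enum A | e \in T] = (v != r).
Proof.
move=> trT; apply/hasP/idP => [[f]|vr].
  rewrite mem_filter => /andP[fT _] /eqP <-; case/traP: trT => + _ _ _; exact.
by case: (in_arc trT vr) => f fT fv; exists f; rewrite ?fv // mem_filter fT mem_enum.
Qed.

Lemma t_decide_enc r r' : tra (@label I) r (source I) -> tra (@label I) r' (target I) ->
  t_decide x = connect (root_rel (@label I)) r r'.
Proof.
move=> tr tr'; rewrite /t_decide t_ends_enc /t_source /t_target /= !t_select_enc.
case: (posnP (na (graph I))) => [na0|na_gt0].
  (* Without arcs the test is vacuous, and the roots agree because an arc would have to enter [r']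
     otherwise. *)
  have noarc (e : A) : False by have := ltn_ord e; rewrite {2}na0.
  have -> : ends = [::] by apply/nilP; rewrite /nilp /ends size_cat (size_map tl) (size_map hd) size_enum_ord na0.
  symmetry; have [->|/(in_arc tr)[e]] := eqVneq r' r; [exact: connect0|by case: (noarc e)].
rewrite filter_map saturate_map (eq_saturate _ _ t_root_rel_enc) all_map.
have -> : [seq v <- ends | preim enc_v (fun v => ~~ t_covers
    [seq enc_e i | i <- enum A & i \in source I] v) v] = [seq v <- ends | v == r].
  by apply: eq_filter => v; rewrite /= t_covers_enc (tra_covered _ tr) negbK.
have memE v : (v \in saturate (root_rel (@label I)) ends [seq v <- ends | v == r]) =
    connect (root_rel (@label I)) r v.
  rewrite mem_saturate.
  - apply/hasP/idP => [[u]|rv]; first by rewrite mem_filter => /andP[/eqP->].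
    by exists r; rewrite // mem_filter eqxx ends_all.
  - move=> u w /existsP[e /andP[_ /orP[/andP[_ /eqP <-]|/andP[/eqP <- _]]]].
      exact: mem_hd.
    exact: mem_tl.
  - by rewrite cardE; apply: uniq_leq_size (enum_uniq _) _ => v' _; apply: ends_all.
have hasE v : has (fun u => beq u (enc_v v)) (map enc_v (saturate (root_rel (@label I)) ends
    [seq v <- ends | v == r])) = connect (root_rel (@label I)) r v.
  rewrite has_map -memE -has_pred1; apply: eq_has => u.
  by rewrite /= beq_enc.
(* The target covers every vertex but [r'], so the test says something only there. *)
apply/allP/idP => [h|rr' v _]; last first.
  by rewrite /= t_covers_enc (tra_covered _ tr') hasE; case: eqVneq => //= ->.
have := h r' (ends_all na_gt0 r'); rewrite /= t_covers_enc (tra_covered _ tr') hasE.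
by rewrite eqxx.
Qed.

End Instance.

(** Every vertex but the root is a head. The root is a tail: either of a given arc, or of the first
    arc on the walk from the root to the tail of that arc. *)
Lemma tra_ends_all I r : tra (@label I) r (source I) -> 0 < na (graph I) ->
  forall v, v \in ends I.
Proof.
move=> tr na_gt0 v; have [->|vr] := eqVneq v r; last first.
  by case: (in_arc tr vr) => e _ <-; apply: mem_hd.
pose e := Ordinal na_gt0; have [<-|er] := eqVneq (arc_tail e) r; first exact: mem_tl.
case/traP: tr => _ _ conn _; case: (connect_diwalk (conn (arc_tail e))) => -[|f p] /=.
  by move/eqP => re; rewrite re eqxx in er.
by case/and3P=> _ /eqP <- _; apply: mem_tl.
Qed.

Lemma t_decideP I : valid_instance I -> t_decide (enc_instance I) <-> reconfigurable I.
Proof.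
case=> lab0 /time_respecting_arborescenceE[r tr] /time_respecting_arborescenceE[r' tr'].
rewrite (t_decide_enc lab0 (tra_ends_all tr) tr tr').
by rewrite -(reach_connect_root tr tr'); apply: reach_reconfiguration.
Qed.

Theorem theorem2 :
  poly_time_decidable enc_instance valid_instance reconfigurable.
Proof.
case: ptimeb_t_decide => F [i [h [[k hk] run]]].
(* The main expression is the body of entry [i], and the polynomial is the bound of [pbound] with
   ['X] for the size. *)
exists F, (nth ENil F i), (('X + 2%:R%:P) ^+ k)%R => I vI.
case: (run (enc_instance I)) => t ev le_t; exists (t_decide (enc_instance I)), t.
split=> //; last exact: t_decideP.
rewrite horner_exp hornerD hornerX hornerC natrXE natrDE.
apply: leq_trans (leq_trans (leq_addr _ _) (leq_trans le_t (hk _))) _.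
by rewrite addn2.
Qed.
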